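(* A sesquilinear form $\Omega$ on $\mathcal{D}$ is q-closed with respect to an inner product if and only if there exist a positive self-adjoint operator $H$, with domain $D(H)=\mathcal{D}$ and $0\in\rho(H)$, and $Q\in\mathcal{B}(\mathcal{H})$ such that $$\Omega(\xi,\eta)=\langle QH\xi,H\eta\rangle,\qquad\forall\,\xi,\eta\in\mathcal{D}.\qquad( * )$$ Suppose that $( * )$ holds with $Q$ and $H$ of this kind. Then: 1. a bounded sesquilinear form $\Upsilon$ on $\mathcal{H}$ with associated bounded operator $B$ (that is, $\Upsilon(\xi,\eta)=\langle B\xi,\eta\rangle$ for all $\xi,\eta\in\mathcal{H}$) belongs to $\mathfrak{P}(\Omega)$ if and only if $Q+H^{-1}BH^{-1}$ is a bijection of $\mathcal{H}$; 2. if $\Omega$ is also solvable, then its associated operator is $T=HQH$ defined on the natural domain $D(T)=\{\xi\in\mathcal{D}: QH\xi\in\mathcal{D}\}$.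
   Context: $\mathcal{H}$ is a complex Hilbert space with inner product $\langle\cdot,\cdot\rangle$ (linear in the first variable) and norm $\|\cdot\|$; $\mathcal{D}$ is a dense subspace of $\mathcal{H}$; sesquilinear forms are linear in the first and conjugate-linear in the second variable. $\mathcal{B}(\mathcal{H})$ is the set of bounded everywhere defined operators on $\mathcal{H}$ and $\rho(A)$ denotes the resolvent set of $A$. A sesquilinear form $\Omega$ on $\mathcal{D}$ is q-closed with respect to a norm $\|\cdot\|_\Omega$ on $\mathcal{D}$ if: (i) there is $\alpha>0$ with $\|\xi\|\le\alpha\|\xi\|_\Omega$ for all $\xi\in\mathcal{D}$; (ii) $\mathcal{E}_\Omega:=(\mathcal{D},\|\cdot\|_\Omega)$ is a reflexive Banach space; (iii) there is $\beta>0$ with $|\Omega(\xi,\eta)|\le\beta\|\xi\|_\Omega\|\eta\|_\Omega$ for all $\xi,\eta\in\mathcal{D}$. If $\mathcal{E}_\Omega$ is a Hilbert space, $\Omega$ is called q-closed with respect to the inner product of $\mathcal{E}_\Omega$. Let $\mathcal{E}_\Omega^\times$ be the space of bounded conjugate linear functionals on $\mathcal{E}_\Omega$. $\mathfrak{P}(\Omega)$ is the set of bounded sesquilinear forms $\Upsilon$ on $\mathcal{H}$ such that: (1) if $\xi\in\mathcal{D}$ and $(\Omega+\Upsilon)(\xi,\eta)=0$ for all $\eta\in\mathcal{D}$ then $\xi=0$; (2) for every $\Lambda\in\mathcal{E}_\Omega^\times$ there is $\xi\in\mathcal{D}$ with $\Lambda(\eta)=(\Omega+\Upsilon)(\xi,\eta)$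 for all $\eta\in\mathcal{D}$. $\Omega$ is solvable (with respect to $\|\cdot\|_\Omega$) if it is q-closed and $\mathfrak{P}(\Omega)\neq\emptyset$. It is known that any two norms with respect to which a given form is q-closed are equivalent, so $\mathfrak{P}(\Omega)$ and solvability do not depend on the choice of such a norm. The operator $T$ associated to a solvable form $\Omega$ is given by: $\xi\in D(T)$ and $T\xi=\chi$ if and only if $\xi\in\mathcal{D}$, $\chi\in\mathcal{H}$ and $\Omega(\xi,\eta)=\langle\chi,\eta\rangle$ for all $\eta\in\mathcal{D}$. *)

(* Defs.v *)
From HB Require Import structures.
From mathcomp Require Import all_boot all_order all_algebra.
From mathcomp Require Import sesquilinear complex.
From mathcomp Require Import all_classical all_reals all_analysis.

Set Implicit Arguments.
Unset Strict Implicit.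
Unset Printing Implicit Defensive.

Import Order.TTheory GRing.Theory Num.Theory Num.Def.
Import numFieldNormedType.Exports.

Local Open Scope classical_set_scope.
Local Open Scope ring_scope.
Local Open Scope complex_scope.

(* Norms and bounds take their values in R[i], as `|x| does on a
   normedModType R[i]; since 0 <= z and 0 < z in R[i] force z to be real, these
   are the usual real inequalities. *)

Notation "{ 'sesquilinear' U }" :=
  {bilinear U -> U -> complex _ | *%R & (conjC \; *%R)}
  (format "{ 'sesquilinear'  U }") : ring_scope.
Notation "{ 'antilinear' U }" := {linear U -> complex _ | (conjC \; *%R)}
  (format "{ 'antilinear'  U }") : ring_scope.

Definition bounded_map (R : realType) (E F : normedModType R[i]) (f : E -> F) :=
  exists M : R[i], forall x, `|f x| <= M * `|x|.

Definition bounded_form (R : realType) (E : normedModType R[i])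
    (f : E -> E -> R[i]) :=
  exists M : R[i], forall x y, `|f x y| <= M * `|x| * `|y|.

Section dual.
Context {R : realType} (E : normedModType R[i]).

Definition dual_pred : {pred E -> R[i]^o} :=
  fun f => `[< linear f /\ bounded_map f >].

Record dual := Dual { dual_fun :> E -> R[i]^o ; _ : dual_fun \in dual_pred }.

HB.instance Definition _ := [isSub for dual_fun].
HB.instance Definition _ := [Choice of dual by <:].

Fact dual_submod_closed : submod_closed dual_pred.
Proof.
split.
  apply/asboolP; split; first by move=> a x y; rewrite scaler0 addr0.
  by exists 0 => x; rewrite normr0 mul0r.
move=> a f g /asboolP[lf [M fM]] /asboolP[lg [K gK]]; apply/asboolP; split.
  move=> b x y; rewrite !fctE lf lg !scalerDr !scalerA mulrC -!addrA.
  by congr (_ + _); rewrite addrCA.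
exists (`|a| * M + K) => x; rewrite !fctE mulrDl -mulrA.
apply: le_trans (ler_normD _ _) _; apply: lerD => //.
by rewrite normrZ ler_wpM2l.
Qed.
HB.instance Definition _ :=
  GRing.isSubmodClosed.Build R[i] (E -> R[i]^o) dual_pred dual_submod_closed.
HB.instance Definition _ := [SubChoice_isSubLmodule of dual by <:].

Definition dual_bounds (f : dual) : set R :=
  [set M | 0 <= M /\ forall x, `|f x| <= M%:C * `|x|].

(* The operator norm of f, as its least bound. *)
Definition dual_norm (f : dual) : R[i] := (inf (dual_bounds f))%:C.

Let normE (F : normedModType R[i]) (x : F) : `|x| = (complex.Re `|x|)%:C.
Proof. by rewrite RRe_real// ger0_real. Qed.

Fact dual_bounds_has_inf (f : dual) : has_inf (dual_bounds f).
Proof.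
split; last by exists 0 => M [].
have /asboolP[_ [M fM]] := valP f; exists `|complex.Re M|; split=> // x.
have [->|x0] := eqVneq x 0.
  by have := fM 0; rewrite !normr0 !mulr0.
have Mge0 : 0 <= M.
  by rewrite -(pmulr_lge0 _ (_ : 0 < `|x|)) ?normr_gt0// (le_trans _ (fM x)).
apply: le_trans (fM x) _; rewrite ler_wpM2r//.
by rewrite -{1}(RRe_real (ger0_real Mge0)) lecR ler_norm.
Qed.

Fact dual_normP (f : dual) x : `|f x| <= dual_norm f * `|x|.
Proof.
have [B0 _] := dual_bounds_has_inf f.
have [->|x0] := eqVneq x 0.
  by have [M [_ /(_ 0)]] := B0; rewrite !normr0 !mulr0.
have nx0 : 0 < complex.Re `|x| by rewrite -ltcR -normE normr_gt0.
rewrite /dual_norm [`|x|]normE [`|f x|]normE -rmorphM lecR -ler_pdivrMr//.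
apply: lb_le_inf => // M [_ /(_ x)].
by rewrite [`|x|]normE [`|f x|]normE -rmorphM lecR -ler_pdivrMr.
Qed.

Fact dual_norm_le (f : dual) (M : R) : 0 <= M ->
  (forall x, `|f x| <= M%:C * `|x|) -> dual_norm f <= M%:C.
Proof.
by move=> M0 fM; rewrite lecR; apply: ge_inf => //; have [] := dual_bounds_has_inf f.
Qed.

Let dual_norm_ge0 (f : dual) : 0 <= inf (dual_bounds f).
Proof.
by apply: lb_le_inf => [|M []//]; have [] := dual_bounds_has_inf f.
Qed.

Fact dual_norm_triangle (f g : dual) :
  dual_norm (f + g) <= dual_norm f + dual_norm g.
Proof.
rewrite -rmorphD/=; apply: dual_norm_le => [|x]; first exact: addr_ge0.
rewrite rmorphD mulrDl; apply: le_trans (ler_normD _ _) _.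
by apply: lerD; exact: dual_normP.
Qed.

Let dual_normZ_le (a : R[i]) (f : dual) :
  dual_norm (a *: f) <= `|a| * dual_norm f.
Proof.
have aE : `|a| = (complex.Re `|a|)%:C by rewrite RRe_real// ger0_real.
have -> : `|a| * dual_norm f = (complex.Re `|a| * inf (dual_bounds f))%:C.
  by rewrite rmorphM/= -aE.
apply: dual_norm_le => [|x].
  by apply: mulr_ge0 => //; rewrite -lecR -aE; exact: normr_ge0.
rewrite rmorphM/= -aE -mulrA normrZ ler_wpM2l//.
exact: dual_normP.
Qed.

Fact dual_normZ (a : R[i]) (f : dual) : dual_norm (a *: f) = `|a| * dual_norm f.
Proof.
apply/eqP; rewrite eq_le dual_normZ_le/=.
have [->|a0] := eqVneq a 0.
  by rewrite normr0 mul0r lecR.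
rewrite -ler_pdivlMl ?normr_gt0// -normfV.
by rewrite -[f in leLHS](scale1r f) -(mulVf a0) -scalerA dual_normZ_le.
Qed.

Fact dual_norm_eq0 (f : dual) : dual_norm f = 0 -> f = 0.
Proof.
move=> f0; apply/val_inj/funext => x; apply/eqP.
by rewrite -normr_le0 (le_trans (dual_normP f x))// f0 mul0r.
Qed.

HB.instance Definition _ := Lmodule_isNormed.Build R[i] dual
  dual_norm_triangle dual_normZ dual_norm_eq0.

End dual.

Definition reflexive_space (R : realType) (E : normedModType R[i]) :=
  forall Phi : dual (dual E), exists x : E, forall f : dual E, Phi f = f x.

Definition complete_space (R : realType) (E : normedModType R[i]) :=
  forall F : set_system E, ProperFilter F -> cauchy F -> cvg F.

Record norm_on (R : realType) (V : lmodType R[i]) := NormOn {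
  normfun :> V -> R[i] ;
  normfunD : forall x y, normfun (x + y) <= normfun x + normfun y ;
  normfunZ : forall a x, normfun (a *: x) = `|a| * normfun x ;
  normfun0_eq0 : forall x, normfun x = 0 -> x = 0 }.

(* An alias of V, carrying the normed space structure given by N. *)
Definition normed_by (R : realType) (V : lmodType R[i]) (N : norm_on V) : Type :=
  V.

HB.instance Definition _ (R : realType) (V : lmodType R[i]) (N : norm_on V) :=
  GRing.Lmodule.on (normed_by N).
HB.instance Definition _ (R : realType) (V : lmodType R[i]) (N : norm_on V) :=
  Lmodule_isNormed.Build R[i] (normed_by N)
    (@normfunD R V N) (@normfunZ R V N) (@normfun0_eq0 R V N).

(* A subspace of H is given by a predicate P and a type D : subLmodType P, the
   linear injection of D into H being \val.  A linear operator in H with domain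
   this subspace is a linear map D -> H. *)
Section forms.
Context (R : realType) (H : normedModType R[i]) (P : {pred H})
  (D : subLmodType P).
Implicit Types (N : norm_on D) (Omega : {sesquilinear D}).

Definition q_closed N Omega :=
  [/\ exists2 alpha : R[i], 0 < alpha &
        forall xi : D, `|\val xi| <= alpha * N xi,
      complete_space (normed_by N),
      reflexive_space (normed_by N) &
      exists2 beta : R[i], 0 < beta &
        forall xi eta : D, `|Omega xi eta| <= beta * N xi * N eta].

Definition q_closed_inner Omega :=
  exists (ip : {dot D for conjC}) (N : norm_on D),
    (forall xi, N xi ^+ 2 = ip xi xi) /\ q_closed N Omega.

Definition bounded_antilinear N (Lambda : {antilinear D}) :=
  exists M : R[i], forall eta, `|Lambda eta| <= M * N eta.

Definition frakP N Omega : set {sesquilinear H} :=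
  [set Ups | [/\ bounded_form Ups,
    forall xi : D,
      (forall eta : D, Omega xi eta + Ups (\val xi) (\val eta) = 0) -> xi = 0 &
    forall Lambda : {antilinear D}, bounded_antilinear N Lambda ->
      exists xi : D, forall eta : D,
        Lambda eta = Omega xi eta + Ups (\val xi) (\val eta)]].

Definition solvable Omega :=
  exists N, q_closed N Omega /\ frakP N Omega !=set0.

Definition resolvent_set (T : {linear D -> H}) : set R[i] :=
  [set lambda | exists S : {linear H -> H}, [/\ bounded_map S,
    forall xi : D, S (T xi - lambda *: \val xi) = \val xi &
    forall chi : H, exists2 xi : D, \val xi = S chi &
      T xi - lambda *: \val xi = chi]].

(* The inverse of T when T is a bijection from D onto H. *)
Definition op_inv (T : {linear D -> H}) : H -> D := 'pinv_(fun=> 0) setT T.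

Definition op_graph (T : {linear D -> H}) : set (H * H) :=
  [set (\val xi, T xi) | xi in setT].

(* The graph of T Q T on its natural domain: such a zeta exists exactly when
   Q (T xi) lies in the domain of T. *)
Definition sandwich_graph (T : {linear D -> H}) (Q : H -> H) : set (H * H) :=
  [set p | exists xi zeta : D,
    [/\ p.1 = \val xi, \val zeta = Q (T xi) & p.2 = T zeta]].

Variable ip : {dot H for conjC}.

Definition adjoint_graph (T : {linear D -> H}) : set (H * H) :=
  [set p | forall xi : D, ip (T xi) p.1 = ip (\val xi) p.2].

(* Meaningful for a dense domain, as adjoint_graph is then a functional graph. *)
Definition self_adjoint (T : {linear D -> H}) := op_graph T = adjoint_graph T.

Definition positive_op (T : {linear D -> H}) :=
  forall xi : D, 0 <= ip (T xi) (\val xi).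

Definition assoc_graph Omega : set (H * H) :=
  [set p | exists2 xi : D, \val xi = p.1 &
    forall eta : D, Omega xi eta = ip p.2 (\val eta)].

End forms.

(* Main.v *)
(* In one direction the Riesz theorem gives K : H -> E with <K x, xi>_E = <x, xi>,
   and with S the positive square root of K, seen as an operator in H, S x |-> K x
   is isometric from a dense subspace of H into a dense subspace of E; hence S has
   range D, and its inverse is the required positive self-adjoint operator.  In
   the other direction the graph norm |A xi| is a Hilbert norm on D for which
   Omega is q-closed.  By the closed graph theorem it is equivalent to every other
   such norm, so the conditions defining P(Omega) say precisely that
   Q + A^-1 B A^-1 is injective and surjective. *)

Require Import Defs.
From HB Require Import structures.
From mathcomp Require Import all_boot all_order all_algebra.
From mathcomp Require Import sesquilinear complex.
From mathcomp Require Import all_classical all_reals all_analysis.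
From mathcomp Require Import ring lra.

Set Implicit Arguments.
Unset Strict Implicit.

Import Order.TTheory GRing.Theory Num.Theory Num.Def.
Import numFieldNormedType.Exports.

Local Open Scope classical_set_scope.
Local Open Scope ring_scope.
Local Open Scope complex_scope.

(** * Seminorms, sequential completeness and the closed graph theorem *)

(** [D] carries several norms at once (that of [H], a given [N], the graph norm), so the analysis is
    done for plain real-valued functions on a vector space and along sequences, not for one
    canonical normed structure. [A] is unbounded, so arguments run through its inverse, which is
    bounded, symmetric and defined on all of [H]; domain questions become questions about ranges.
    The square root is what makes the domain come out right: the range of [K] is in general smaller
    than [D], that of its root is exactly [D]. The root is built by an iteration on bounded
    operators, without spectral theory. Two norms have to be compared because the criterion for
    P(Omega) concerns every [N] for which the form is q-closed, while bijectivity on [H] is directly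
    visible only for the graph norm. *)

Section seminorms.
Context {R : realType} {V : lmodType R[i]}.
Implicit Types (p q : V -> R) (u v : nat -> V).

(** Homogeneity is over real scalars, the only ones by which the Baire and closed graph arguments
    rescale; complex scalars enter through an explicit bound, as in [seq_limP]. *)
Definition seminorm p :=
  (forall x y, p (x + y) <= p x + p y) /\
  (forall (c : R) x, p (c%:C *: x) = `|c| * p x).

Definition seq_lim p u l := forall e : R, 0 < e ->
  exists n0, forall n, (n0 <= n)%N -> p (u n - l) < e.

Definition seq_cauchy p u := forall e : R, 0 < e ->
  exists n0, forall m n, (n0 <= m)%N -> (n0 <= n)%N -> p (u m - u n) < e.

Definition seq_complete p :=
  forall u, seq_cauchy p u -> exists l, seq_lim p u l.

Lemma seminorm0 p : seminorm p -> p 0 = 0.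
Proof. by move=> [_ /(_ 0 0)]; rewrite scaler0 normr0 mul0r. Qed.

Lemma seminormN p x : seminorm p -> p (- x) = p x.
Proof.
by move=> [_ /(_ (-1) x)]; rewrite rmorphN rmorph1 scaleN1r normrN1 mul1r.
Qed.

Lemma seminormB p x y : seminorm p -> p (x - y) = p (y - x).
Proof. by move=> sp; rewrite -(seminormN _ sp) opprB. Qed.

Lemma seminorm_ge0 p x : seminorm p -> 0 <= p x.
Proof.
move=> sp; have := sp.1 x (- x).
by rewrite subrr (seminorm0 sp) (seminormN _ sp); lra.
Qed.

Lemma seminorm_triangle p z x y : seminorm p -> p (x - y) <= p (x - z) + p (z - y).
Proof. by move=> sp; have := sp.1 (x - z) (z - y); rewrite subrKA. Qed.

Lemma seq_lim_cauchy p u l : seminorm p -> seq_lim p u l -> seq_cauchy p u.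
Proof.
move=> sp ul e e0; have [n0 un0] := ul (e / 2) ltac:(lra).
exists n0 => m n /un0 um /un0 un; have := seminorm_triangle l (u m) (u n) sp.
by rewrite (seminormB l _ sp); lra.
Qed.

Lemma seq_lim_unique p u l k : seminorm p -> (forall x, p x = 0 -> x = 0) ->
  seq_lim p u l -> seq_lim p u k -> l = k.
Proof.
move=> sp p0 ul uk; apply/subr0_eq/p0/eqP.
rewrite eq_le seminorm_ge0// andbT; apply/ler_addgt0Pr => e e0; rewrite add0r.
have [n1 H1] := ul (e / 2) ltac:(lra).
have [n2 H2] := uk (e / 2) ltac:(lra).
have := H1 (maxn n1 n2) (leq_maxl _ _); have := H2 (maxn n1 n2) (leq_maxr _ _).
have := seminorm_triangle (u (maxn n1 n2)) l k sp.
by rewrite (seminormB l (u _) sp); lra.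
Qed.

Lemma seq_limP p u v l k (a : R[i]) (M : R) : seminorm p ->
  (forall x, p (a *: x) <= M * p x) ->
  seq_lim p u l -> seq_lim p v k ->
  seq_lim p (fun n => a *: u n + v n) (a *: l + k).
Proof.
move=> sp pa ul vk e e0; have M1 : 0 < `|M| + 1 by have := normr_ge0 M; lra.
have [n1 H1] := ul (e / 2 / (`|M| + 1)) ltac:(apply: divr_gt0; lra).
have [n2 H2] := vk (e / 2) ltac:(lra).
exists (maxn n1 n2) => n; rewrite geq_max => /andP[/H1 + /H2].
rewrite opprD addrACA -scalerBr ltr_pdivlMr// => lt1 lt2.
have := sp.1 (a *: (u n - l)) (v n - k); have := pa (u n - l).
have := ler_norm M; have := seminorm_ge0 (u n - l) sp; nra.
Qed.

Lemma geometric_lt (c e : R) : 0 < e -> exists n, c / 2 ^+ n < e.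
Proof.
move=> e0; exists (truncn (`|c| / e)).+1.
rewrite ltr_pdivrMr ?exprn_gt0//.
have H1 := truncnS_gt (`|c| / e).
have H2 : ((truncn (`|c| / e)).+1%:R : R) <= 2 ^+ (truncn (`|c| / e)).+1.
  by rewrite -natrX ler_nat; apply/ltnW/ltn_expl.
rewrite ltr_pdivrMr// in H1.
have := ler_norm c; nra.
Qed.

Lemma geometric_dist p u (c : R) m n : seminorm p ->
  (forall n, p (u n.+1 - u n) <= c / 2 ^+ n.+1) -> (n <= m)%N ->
  p (u m - u n) <= c / 2 ^+ n - c / 2 ^+ m.
Proof.
move=> sp uc; elim: m => [|m IHm].
  by rewrite leqn0 => /eqP->; rewrite !subrr (seminorm0 sp).
rewrite leq_eqVlt => /predU1P[->|].
  by rewrite !subrr (seminorm0 sp).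
rewrite ltnS => /IHm le; have := seminorm_triangle (u m) (u m.+1) (u n) sp.
have := uc m; rewrite exprS invfM => le2.
by lra.
Qed.

Lemma geometric_cauchy p u (c : R) : seminorm p -> 0 <= c ->
  (forall n, p (u n.+1 - u n) <= c / 2 ^+ n.+1) -> seq_cauchy p u.
Proof.
move=> sp c0 uc e e0; have [n0 Hn0] := geometric_lt c e0.
have H m n : (n0 <= n)%N -> (n <= m)%N -> p (u m - u n) < e.
  move=> n0n nm; have := geometric_dist sp uc nm.
  have : 0 <= c / 2 ^+ m by rewrite divr_ge0// exprn_ge0.
  have : c / 2 ^+ n <= c / 2 ^+ n0.
    by rewrite ler_wpM2l// lef_pV2 ?posrE ?exprn_gt0// ler_eXn2l// ltr1n.
  by lra.
exists n0 => m n n0m n0n; have [nm|/ltnW mn] := leqP n m; first exact: H.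
by rewrite seminormB//; exact: H.
Qed.

(* Otherwise nested q-balls would shrink to a point at which p exceeds every k. *)
Lemma baire_seminorm p q : seminorm p -> seminorm q -> seq_complete q ->
  exists (k : nat) x0 (r : R), 0 < r /\ forall x, q (x - x0) < r ->
    forall e, 0 < e -> exists z, p z <= k%:R /\ q (x - z) < e.
Proof.
move=> sp sq cq; apply: contrapT => H.
(* If [{p <= k}] is dense in no ball, every ball contains a smaller one, of at most half the radius,
   on which [p > k]. *)
have step (t : nat * (V * R)) : 0 < t.2.2 -> exists s : V * R,
    [/\ 0 < s.2, s.2 <= t.2.2 / 2, q (s.1 - t.2.1) <= t.2.2 / 2 &
       forall z, q (s.1 - z) <= s.2 -> t.1%:R < p z].
  case: t => k [x0 r]/= r0; apply: contrapT => K; apply: H.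
  exists k, x0, (r / 2); split=> [|x xx0 e e0]; first lra.
  apply: contrapT => L; apply: K; exists (x, Num.min (r / 2) (e / 2)) => /=.
  split=> [| | |z xz]; rewrite ?lt_min ?ge_min ?lexx//; try lra.
  rewrite ltNge; apply/negP => pz; apply: L; exists z; split=> //.
  by move: xz; rewrite le_min => /andP[]; lra.
have [F HF] : exists F : nat * (V * R) -> V * R, forall t, 0 < t.2.2 ->
    [/\ 0 < (F t).2, (F t).2 <= t.2.2 / 2, q ((F t).1 - t.2.1) <= t.2.2 / 2 &
       forall z, q ((F t).1 - z) <= (F t).2 -> t.1%:R < p z].
  have /choice[F HF] t : exists s : V * R, 0 < t.2.2 ->
    [/\ 0 < s.2, s.2 <= t.2.2 / 2, q (s.1 - t.2.1) <= t.2.2 / 2 &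
       forall z, q (s.1 - z) <= s.2 -> t.1%:R < p z].
    have [/step[s Hs]|t0] := boolP (0 < t.2.2 :> R); first by exists s.
    (* Junk pair: the claim is vacuous for a nonpositive radius. *)
    by exists (0, 0).
  by exists F.
pose fix G n := if n is m.+1 then F (m, G m) else ((0, 1) : V * R).
have G0 n : 0 < (G n).2.
  by elim: n => [|n IHn] //=; have [] := HF (n, G n) IHn.
have Gle n : (G n).2 <= 1 / 2 ^+ n.
  elim: n => [|n IHn]; first by rewrite expr0 divr1.
  have [_ /= + _ _] := HF (n, G n) (G0 n); rewrite exprS invfM.
  by lra.
have Gstep n : q ((G n.+1).1 - (G n).1) <= 1 / 2 ^+ n.+1.
  have [_ _ /= + _] := HF (n, G n) (G0 n); have := Gle n.
  by rewrite exprS invfM; lra.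
have [l ul] := cq _ (geometric_cauchy (u := fun n => (G n).1) sq ler01 Gstep).
(* Shift of the centre plus remaining radius stays within the earlier radius: the balls are nested,
   so the limit lies in all of them. *)
have Gdist n k : q ((G (n + k)%N).1 - (G n).1) + (G (n + k)%N).2 <= (G n).2.
  elim: k => [|k IHk]; first by rewrite addn0 subrr (seminorm0 sq) add0r.
  rewrite addnS.
  have [_ /= le1 le2 _] := HF ((n + k)%N, G (n + k)%N) (G0 _).
  have := seminorm_triangle (G (n + k)%N).1 (G (n + k).+1).1 (G n).1 sq.
  by move: IHk le1 le2 => /=; lra.
have pl n : (n%:R : R) < p l.
  have [_ _ _ /= H4] := HF (n, G n) (G0 n); apply: H4.
  apply/ler_addgt0Pr => e e0; have [n0 Hn0] := ul e e0.
  have := Hn0 (n.+1 + n0)%N (leq_addl _ _); have := Gdist n.+1 n0.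
  have := G0 (n.+1 + n0)%N.
  have := seminorm_triangle (G (n.+1 + n0)%N).1 (G n.+1).1 l sq.
  by rewrite (seminormB (G n.+1).1 (G _).1 sq) /=; lra.
have := pl (truncn (p l)).+1; have := truncnS_gt (p l); lra.
Qed.

(** The map in question is the identity from [(V, q)] to [(V, p)]; the last hypothesis says that its
    graph is closed. By Baire each [x] is approximated up to [q x / 2] by some [z] with
    [p z <= c * q x]; repeating this on the residual gives a series that converges for [p], and
    closedness identifies its sum with [x]. *)
Lemma closed_graph p q : seminorm p -> seminorm q ->
  seq_complete p -> seq_complete q -> (forall x, q x = 0 -> x = 0) ->
  (forall u x y, seq_lim p u x -> seq_lim q u y -> x = y) ->
  exists2 C : R, 0 < C & forall x, p x <= C * q x.
Proof.
move=> sp sq cp cq q0 pq.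
have [k [x0 [r [r0 Hk]]]] := baire_seminorm sp sq cq.
have sZ s (c : R) x : seminorm s -> 0 <= c -> s (c%:C *: x) = c * s x.
  by move=> [_ ->] /ger0_norm->.
(* A vector is rescaled to [q]-norm [r / 2], approximated within [{p <= k}] and scaled back; [k + 1]
   keeps [c] positive when [k = 0]. *)
pose c : R := 2 * (k%:R + 1) / r.
have c0 : 0 < c by rewrite divr_gt0// mulr_gt0// -natr1 addr_gt0// ltr0n.
(* The ball is moved from [x0] to the origin: half the difference of approximants of [x0 + x] and
   [x0 - x] approximates [x]. *)
have ball0 x e : q x < r -> 0 < e -> exists z, p z <= k%:R /\ q (x - z) < e.
  move=> xr e0.
  have [|z1 [pz1 qz1]] := Hk (x0 + x) _ e e0; first by rewrite addrAC subrr add0r.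
  have [|z2 [pz2 qz2]] := Hk (x0 - x) _ e e0.
    by rewrite addrAC subrr add0r seminormN.
  exists ((2^-1 : R)%:C *: (z1 - z2)); split.
    rewrite sZ// ?invr_ge0//; have := sp.1 z1 (- z2); rewrite seminormN//.
    by lra.
  have -> : x - (2^-1 : R)%:C *: (z1 - z2) =
      (2^-1 : R)%:C *: ((x0 + x - z1) - (x0 - x - z2)).
    have -> : (x0 + x - z1) - (x0 - x - z2) = (x + x) - (z1 - z2).
      rewrite !opprD !opprK addrACA; congr (_ + _).
      by rewrite addrACA subrr add0r.
    rewrite [RHS]scalerBr; congr (_ - _).
    rewrite scalerDr -scalerDl -rmorphD/= (_ : 2^-1 + 2^-1 = 1) ?scale1r//.
    by lra.
  rewrite sZ// ?invr_ge0//.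
  have := sq.1 (x0 + x - z1) (- (x0 - x - z2)); rewrite (seminormN (x0 - x - z2) sq).
  by lra.
have approx x : exists z, p z <= c * q x /\ q (x - z) <= q x / 2.
  have [->|x0'] := eqVneq x 0.
    by exists 0; rewrite subr0 !seminorm0// mulr0 mul0r.
  have qx : 0 < q x.
    rewrite lt_def seminorm_ge0// andbT; apply/negP => /eqP/q0/eqP.
    by rewrite (negbTE x0').
  pose t := r / (2 * q x).
  have t0 : 0 < t by rewrite divr_gt0// mulr_gt0.
  have t0' : 0 <= t by exact: ltW.
  have ti0 : 0 <= t^-1 by rewrite invr_ge0.
  have tq : t * q x = r / 2.
    by rewrite /t; field; rewrite gt_eqF.
  have [||z [pz qz]] := ball0 (t%:C *: x) (r / 4).
  - by rewrite sZ// tq; lra.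
  - by lra.
  exists (t^-1%:C *: z); split.
    rewrite sZ//.
    apply: (@le_trans _ _ (t^-1 * (k%:R + 1))).
      by rewrite ler_wpM2l//; lra.
    rewrite /t /c invf_div le_eqVlt; apply/orP; left; apply/eqP.
    by field; rewrite gt_eqF.
  have -> : x - t^-1%:C *: z = t^-1%:C *: (t%:C *: x - z).
    by rewrite scalerBr scalerA -rmorphM/= mulVf ?gt_eqF// scale1r.
  rewrite sZ//.
  apply: (@le_trans _ _ (t^-1 * (r / 4))).
    by rewrite ler_wpM2l// ltW.
  rewrite le_eqVlt; apply/orP; left; apply/eqP.
  by rewrite /t; field; rewrite !gt_eqF.
have /choice[F HF] := approx.
(* The factor 2 is the sum of the geometric series of the corrections [w n.+1 - w n]. *)
exists (2 * c) => [|x]; first lra.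
pose fix w n := if n is m.+1 then w m + F (x - w m) else 0.
have qw n : q (x - w n) <= q x / 2 ^+ n.
  elim: n => [|n IHn]; first by rewrite subr0 expr0 divr1.
  have [_] := HF (x - w n); rewrite /= -addrA opprD addrA exprS invfM.
  by lra.
have pw n : p (w n.+1 - w n) <= (2 * c * q x) / 2 ^+ n.+1.
  have [+ _] := HF (x - w n); rewrite /= addrAC subrr add0r exprS invfM.
  by have := ler_wpM2l (ltW c0) (qw n); lra.
have qx0 := seminorm_ge0 x sq.
have C0 : 0 <= 2 * c * q x by apply: mulr_ge0 => //; lra.
have [y wy] := cp _ (geometric_cauchy sp C0 pw).
have wx : seq_lim q w x.
  move=> e e0; have [n0 Hn0] := geometric_lt (q x) e0.
  exists n0 => n n0n; rewrite seminormB//.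
  apply: le_lt_trans (qw n) (le_lt_trans _ Hn0).
  by rewrite ler_wpM2l// lef_pV2 ?posrE ?exprn_gt0// ler_eXn2l// ltr1n.
rewrite -{1}(pq _ _ _ wy wx).
have C2 : p y <= 2 * c * q x.
  apply/ler_addgt0Pr => e e0; have [n0 Hn0] := wy e e0.
  have := Hn0 n0 (leqnn _).
  have := geometric_dist sp pw (leq0n n0).
  rewrite (_ : w 0%N = 0)// subr0 expr0 divr1.
  have : 0 <= 2 * c * q x / 2 ^+ n0.
    by rewrite divr_ge0 ?exprn_ge0.
  have := seminorm_triangle (w n0) y 0 sp; rewrite !subr0 (seminormB y _ sp).
  by lra.
exact: C2.
Qed.
End seminorms.

Lemma seq_lim_bounded (R : realType) (V W : lmodType R[i])
    (p : V -> R) (q : W -> R) u v l k (M : R) : seminorm p -> seminorm q ->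
  seq_lim q v k -> (forall n, p (u n - l) <= M * q (v n - k)) -> seq_lim p u l.
Proof.
move=> sp sq vk le e e0; have M1 : 0 < `|M| + 1 by have := normr_ge0 M; lra.
have [n0 H] := vk (e / (`|M| + 1)) ltac:(exact: divr_gt0).
exists n0 => n /H; rewrite ltr_pdivlMr// => lt.
have := le n; have := ler_norm M; have := seminorm_ge0 (v n - k) sq; nra.
Qed.

Lemma seq_lim_seminorm_le (R : realType) (V W : lmodType R[i])
    (p : V -> R) (q : W -> R) u v x y :
  seminorm p -> seminorm q -> seq_lim p u x -> seq_lim q v y ->
  (forall n, p (u n) = q (v n)) -> p x <= q y.
Proof.
move=> sp sq ux vy uv; apply/ler_addgt0Pr => e e0; have e2 : 0 < e / 2 by lra.
have [n1 H1] := ux _ e2; have [n2 H2] := vy _ e2.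
have := H1 (maxn n1 n2) (leq_maxl _ _); have := H2 (maxn n1 n2) (leq_maxr _ _).
have := seminorm_triangle (u (maxn n1 n2)) x 0 sp.
have := seminorm_triangle y (v (maxn n1 n2)) 0 sq.
rewrite !subr0 uv (seminormB x _ sp).
by lra.
Qed.

(** * Inner products and the Riesz theorem *)

Section complex_real_parts.
Context {R : realType}.
Implicit Types (a b : R[i]) (c : R).

Lemma ReD a b : complex.Re (a + b) = complex.Re a + complex.Re b.
Proof. by case: a b => [? ?] []. Qed.

Lemma ReN a : complex.Re (- a) = - complex.Re a.
Proof. by case: a. Qed.

Lemma ReZ c a : complex.Re (c%:C * a) = c * complex.Re a.
Proof. by case: a => x y /=; rewrite mul0r subr0. Qed.

Lemma ReiM a : complex.Re ('i%C * a) = - complex.Im a.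
Proof. by case: a => x y /=; rewrite mul0r mul1r sub0r. Qed.

Lemma Re_conjC a : complex.Re (conjC a) = complex.Re a.
Proof. by case: a. Qed.

Lemma eq_complexP a b :
  complex.Re a = complex.Re b -> complex.Im a = complex.Im b -> a = b.
Proof. by case: a b => [? ?] [? ?] /= -> ->. Qed.

Lemma conjC_real c : conjC (c%:C : R[i]) = c%:C.
Proof. by apply: eq_complexP => //=; rewrite oppr0. Qed.

Definition rnorm (E : normedZmodType R[i]) (x : E) : R := complex.Re `|x|.

Lemma rnormE (E : normedZmodType R[i]) (x : E) : `|x| = (rnorm x)%:C.
Proof. by rewrite /rnorm RRe_real// ger0_real. Qed.

Lemma rnorm_ge0 (E : normedZmodType R[i]) (x : E) : 0 <= rnorm x.
Proof. by rewrite -lecR -rnormE normr_ge0. Qed.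

Lemma Re_le_rnorm a : complex.Re a <= rnorm a.
Proof.
by have := normc_ge_Re a; rewrite rnormE lecR; apply/le_trans/ler_norm.
Qed.

Lemma rnorm_conjC a : rnorm (conjC a) = rnorm a.
Proof. by rewrite /rnorm norm_conjC. Qed.

Lemma rnorm_sqr a : rnorm a ^+ 2 = complex.Re (conjC a * a).
Proof.
have -> : conjC a * a = (rnorm a ^+ 2)%:C by rewrite mulrC -normCK rnormE rmorphXn.
by [].
Qed.

Lemma seminorm_rnorm (E : normedModType R[i]) : seminorm (@rnorm E).
Proof.
split=> [x y|c x]; first by rewrite -lecR rmorphD/= -!rnormE ler_normD.
apply: complexI; rewrite -rnormE normrZ rmorphM/= -rnormE; congr (_ * _).
by apply: eq_complexP; rewrite normc_def//= expr0n addr0 sqrtr_sqr.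
Qed.

Lemma rnorm_eq0 (E : normedZmodType R[i]) (x : E) : rnorm x = 0 -> x = 0.
Proof. by move=> x0; apply/eqP; rewrite -normr_eq0 rnormE x0. Qed.

Lemma complete_space_seq (E : normedModType R[i]) :
  complete_space E -> seq_complete (@rnorm E).
Proof.
move=> cE u cu.
have cau : cauchy (u @ \oo).
  apply: cauchy_exP => e e0.
  have eE : e = (complex.Re e)%:C by rewrite RRe_real// gtr0_real.
  move: e0; rewrite eE ltcR => e0; have [n0 Hn0] := cu _ e0.
  exists (u n0), n0 => // n /= n0n.
  by rewrite -ball_normE /ball_/= rnormE ltcR Hn0.
have ul := cE (u @ \oo) (fmap_proper_filter _ eventually_filter) cau.
exists (lim (u @ \oo)) => e e0.
have e0' : 0 < e%:C by rewrite ltcR.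
have [n0 _ Hn0] := cvgr_dist_lt _ _ ul _ e0'.
exists n0 => n n0n; rewrite seminormB; last exact: seminorm_rnorm.
by rewrite -ltcR -rnormE Hn0.
Qed.

End complex_real_parts.

Section inner_product.
Context {R : realType} {V : lmodType R[i]} (ip : {dot V for conjC}).
Implicit Types (x y z : V) (a : R[i]) (c : R).

Lemma ipC x y : ip x y = conjC (ip y x).
Proof. by rewrite hermC expr0 mul1r. Qed.

Lemma ipDl x y z : ip (x + y) z = ip x z + ip y z.
Proof. exact: linearDl. Qed.

Lemma ipDr x y z : ip z (x + y) = ip z x + ip z y.
Proof. exact: linearDr. Qed.

Lemma ipZl a x y : ip (a *: x) y = a * ip x y.
Proof. exact: linearZl_LR. Qed.

Lemma ipZr a x y : ip y (a *: x) = conjC a * ip y x.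
Proof. exact: linearZr_LR. Qed.

Lemma ipBl x y z : ip (x - y) z = ip x z - ip y z.
Proof. exact: linearBl. Qed.

Lemma ipBr x y z : ip z (x - y) = ip z x - ip z y.
Proof. exact: linearBr. Qed.

Lemma ipP_l a x y z : ip (a *: x + y) z = a * ip x z + ip y z.
Proof. by rewrite ipDl ipZl. Qed.

Lemma ipP_r a x y z : ip z (a *: x + y) = conjC a * ip z x + ip z y.
Proof. by rewrite ipDr ipZr. Qed.

Lemma ip_eq x y : (forall z, ip x z = ip y z) -> x = y.
Proof.
move=> xy; apply/subr0_eq/eqP; rewrite -(dnorm_eq0 ip).
by rewrite linearBl /= xy subrr.
Qed.

Lemma ip_eqr x y : (forall z, ip z x = ip z y) -> x = y.
Proof. by move=> xy; apply: ip_eq => z; rewrite ipC xy -ipC. Qed.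

Definition rip x y : R := complex.Re (ip x y).

Lemma ripC x y : rip x y = rip y x.
Proof. by rewrite /rip ipC Re_conjC. Qed.

Lemma ripDl x y z : rip (x + y) z = rip x z + rip y z.
Proof. by rewrite /rip linearDl ReD. Qed.

Lemma ripZl c x y : rip (c%:C *: x) y = c * rip x y.
Proof. by rewrite /rip linearZl_LR ReZ. Qed.

Lemma ripNl x y : rip (- x) y = - rip x y.
Proof. by rewrite /rip linearNl ReN. Qed.

Lemma ripDr x y z : rip z (x + y) = rip z x + rip z y.
Proof. by rewrite ripC ripDl !(ripC z). Qed.

Lemma ripZr c x y : rip y (c%:C *: x) = c * rip y x.
Proof. by rewrite ripC ripZl ripC. Qed.

Lemma ripE x : ip x x = (rip x x)%:C.
Proof. by rewrite /rip RRe_real// ger0_real// dnorm_ge0. Qed.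

Lemma rip_ge0 x : 0 <= rip x x.
Proof. by rewrite -lecR -ripE dnorm_ge0. Qed.

Lemma rip_expand x y c :
  rip (x + c%:C *: y) (x + c%:C *: y) = rip x x + 2 * c * rip x y + c ^+ 2 * rip y y.
Proof. by rewrite !(ripDl, ripDr) !(ripZl, ripZr) (ripC y x); ring. Qed.

Definition nrm x : R := Num.sqrt (rip x x).

Lemma nrm_ge0 x : 0 <= nrm x. Proof. exact: sqrtr_ge0. Qed.

Lemma nrm_sqr x : nrm x ^+ 2 = rip x x.
Proof. by rewrite sqr_sqrtr// rip_ge0. Qed.

Lemma nrm_eq0 x : nrm x = 0 -> x = 0.
Proof.
move=> x0; apply/eqP; rewrite -(dnorm_eq0 ip) ripE -nrm_sqr x0.
by rewrite expr0n.
Qed.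

(** Common source of the Cauchy-Schwarz estimates below: for the inner product, for the first
    variation at a near-minimiser, and for the form of a positive operator. The value of [t] is the
    minimiser [- a / b], or for [b = 0] a point where the affine function equals -1. *)
Lemma discriminant_le (a b c : R) : 0 <= b ->
  (forall t, 0 <= c + 2 * t * a + t ^+ 2 * b) -> a ^+ 2 <= c * b.
Proof.
rewrite le_eqVlt => /predU1P[<-|b0] H.
  rewrite mulr0; have [->|a0] := eqVneq a 0; first by rewrite expr0n.
  have := H (- (c + 1) / (2 * a)); rewrite mulr0 addr0.
  have -> : c + 2 * (- (c + 1) / (2 * a)) * a = - 1 by field.
  by lra.
have := H (- a / b).
have -> : c + 2 * (- a / b) * a + (- a / b) ^+ 2 * b = (c * b - a ^+ 2) / b.
  by field; rewrite gt_eqF.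
by rewrite pmulr_lge0 ?invr_gt0// subr_ge0.
Qed.

Lemma sqr_le_abs (a b : R) : 0 <= b -> a ^+ 2 <= b ^+ 2 -> `|a| <= b.
Proof. by move=> b0; rewrite -(real_normK (num_real a)) ler_pXn2r ?nnegrE. Qed.

Lemma ripCS x y : `|rip x y| <= nrm x * nrm y.
Proof.
apply: sqr_le_abs; first by rewrite mulr_ge0 ?nrm_ge0.
rewrite exprMn !nrm_sqr; apply: discriminant_le; first exact: rip_ge0.
by move=> t; rewrite -rip_expand rip_ge0.
Qed.

(** The real inequality is applied to [conjC (ip x y) *: x] and [y], whose product is the square of
    the modulus of [ip x y]. *)
Lemma ipCS x y : rnorm (ip x y) <= nrm x * nrm y.
Proof.
have le : rnorm (ip x y) ^+ 2 <= rnorm (ip x y) * (nrm x * nrm y).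
  rewrite {1}rnorm_sqr -linearZl_LR -/(rip _ _).
  apply: le_trans (ler_norm _) (le_trans (ripCS _ _) _).
  rewrite mulrA ler_wpM2r ?nrm_ge0// le_eqVlt; apply/orP; left; apply/eqP.
  rewrite /nrm /rip dnormZ rnormE -rmorphXn/= ReZ rnorm_conjC.
  by rewrite sqrtrM ?sqr_ge0// sqrtr_sqr ger0_norm ?rnorm_ge0.
have := rnorm_ge0 (ip x y); rewrite le_eqVlt => /predU1P[<-|n0].
  by rewrite mulr_ge0 ?nrm_ge0.
by rewrite -(ler_pM2l n0) -expr2.
Qed.

Lemma nrmZ a x : nrm (a *: x) = rnorm a * nrm x.
Proof.
rewrite /nrm /rip dnormZ rnormE -rmorphXn/= ReZ.
by rewrite sqrtrM ?sqr_ge0// sqrtr_sqr ger0_norm ?rnorm_ge0.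
Qed.

Lemma seminorm_nrm : seminorm nrm.
Proof.
split=> [x y|c x].
  rewrite -(ler_pXn2r (ltn0Sn 1)) ?nnegrE ?addr_ge0 ?nrm_ge0//.
  rewrite sqrrD !nrm_sqr ripDl !ripDr (ripC y x).
  by have := le_trans (ler_norm _) (ripCS x y); lra.
rewrite nrmZ; congr (_ * _).
by apply: complexI; rewrite -rnormE normc_def/= expr0n addr0 sqrtr_sqr.
Qed.

Lemma nrm_rnorm (N : V -> R[i]) x : 0 <= N x -> N x ^+ 2 = ip x x -> N x = (nrm x)%:C.
Proof.
move=> N0 Nx; apply/eqP.
rewrite -(eqrXn2 (ltn0Sn 1)) ?lecR ?nrm_ge0// -rmorphXn/= nrm_sqr -ripE.
by apply/eqP.
Qed.

Lemma seq_lim_ip u x y z w (v : nat -> V) : seq_lim nrm u x -> seq_lim nrm v y ->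
  (forall n, ip (u n) z = ip w (v n)) -> ip x z = ip w y.
Proof.
move=> ux vy uv; apply/subr0_eq/rnorm_eq0/eqP.
rewrite eq_le rnorm_ge0 andbT; apply/ler_addgt0Pr => e e0; rewrite add0r.
have z1 : 0 < 2 * (nrm z + 1) by have := nrm_ge0 z; lra.
have w1 : 0 < 2 * (nrm w + 1) by have := nrm_ge0 w; lra.
have [n1 H1] := ux _ (divr_gt0 e0 z1).
have [n2 H2] := vy _ (divr_gt0 e0 w1).
have {H1} := H1 (maxn n1 n2) (leq_maxl _ _).
have {H2} := H2 (maxn n1 n2) (leq_maxr _ _).
move: (maxn n1 n2) => n; rewrite !ltr_pdivlMr// => le2 le1.
have -> : ip x z - ip w y = ip (x - u n) z - ip w (y - v n).
  by rewrite linearBl linearBr /= uv; ring.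
have [sR _] := seminorm_rnorm (R[i]^o : normedModType R[i]).
apply: le_trans (sR (ip (x - u n) z) (- ip w (y - v n))) _.
have := ipCS (x - u n) z; have := ipCS w (y - v n).
have -> : rnorm (- ip w (y - v n)) = rnorm (ip w (y - v n)).
  by rewrite /rnorm normrN.
rewrite (seminormB x (u n) seminorm_nrm) (seminormB y (v n) seminorm_nrm).
have := seminorm_ge0 (u n - x) seminorm_nrm.
have := seminorm_ge0 (v n - y) seminorm_nrm.
by move: le1 le2; lra.
Qed.

End inner_product.

Section riesz.
Context {R : realType} {V : lmodType R[i]} (ip : {dot V for conjC}).
Hypothesis cV : seq_complete (nrm ip).
Local Notation rip := (rip ip).
Local Notation nrm := (nrm ip).

(* A minimising sequence of |w|^2 / 2 - Re f(w) on W is Cauchy by the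
   parallelogram identity, and its limit represents f on W. *)
Lemma riesz_subspace (W : V -> Prop) (f : V -> R[i]) (M : R) :
  W 0 -> (forall a x y, W x -> W y -> W (a *: x + y)) ->
  (forall a x y, f (a *: x + y) = a * f x + f y) ->
  (forall x, rnorm (f x) <= M * nrm x) ->
  exists y u, [/\ forall n, W (u n), seq_lim nrm u y &
    forall w, W w -> f w = ip w y].
Proof.
move=> W0 WP fP fM.
pose J w := rip w w / 2 - complex.Re (f w).
have Jvar x w (t : R) : J (x + t%:C *: w) =
    J x + t * (rip x w - complex.Re (f w)) + t ^+ 2 / 2 * rip w w.
  by rewrite /J rip_expand [x + _]addrC fP ReD ReZ; field.
pose m := inf [set J w | w in W].
have Jinf : has_inf [set J w | w in W].
  split; first by exists (J 0), 0.
  (* The minimum of [t ^+ 2 / 2 - M * t] over real [t]. *)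
  exists (- M ^+ 2 / 2) => _ [w Ww <-].
  have := Re_le_rnorm (f w); have := fM w; rewrite /J -nrm_sqr.
  by have := sqr_ge0 (nrm w - M); lra.
have mJ w : W w -> m <= J w.
  by move=> Ww; apply: ge_inf; [exact: Jinf.2|exists w].
(* The tolerance is half the square of [1 / 2 ^+ n], so that the discriminant inequality bounds the
   first variation at [u n] by [1 / 2 ^+ n * nrm w]. *)
have /choice[u Hu] n : exists w, W w /\ J w < m + (1 / 2 ^+ n) ^+ 2 / 2.
  have [|_ [w Ww <-] lt] := @inf_adherent _ _ ((1 / 2 ^+ n) ^+ 2 / 2) _ Jinf.
    by rewrite divr_gt0// exprn_gt0// divr_gt0// exprn_gt0.
  by exists w.
have d0 n : 0 < 1 / 2 ^+ n :> R by rewrite divr_gt0// exprn_gt0.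
have Wu n w (t : R) : W w -> W (u n + t%:C *: w).
  by move=> Ww; rewrite addrC; apply: WP => //; have [] := Hu n.
have var n w : W w -> `|rip (u n) w - complex.Re (f w)| <= 1 / 2 ^+ n * nrm w.
  move=> Ww; apply: sqr_le_abs; first by rewrite mulr_ge0 ?nrm_ge0// ltW.
  rewrite exprMn nrm_sqr; apply: discriminant_le; first exact: rip_ge0.
  move=> t; have := mJ _ (Wu n w t Ww); rewrite Jvar.
  by have [_] := Hu n; lra.
have cu : seq_cauchy nrm u.
  move=> e e0; have [n0 Hn0] := geometric_lt 1 (ltac:(lra) : 0 < e / 4).
  have le n : (n0 <= n)%N -> 1 / 2 ^+ n < e / 4.
    move=> n0n; apply: le_lt_trans Hn0.
    by rewrite ler_wpM2l// lef_pV2 ?posrE ?exprn_gt0// ler_eXn2l// ltr1n.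
  exists n0 => k n /le k0 /le n0'.
  rewrite ltNge; apply/negP => ge.
  (* If [u k] and [u n] were [e] apart, [J] at their midpoint would fall below [m]: the tolerances
     cost at most [e ^+ 2 / 32], the midpoint gains at least [e ^+ 2 / 8]. *)
  have := mJ (u n + (2^-1)%:C *: (u k - u n)); rewrite Jvar.
  have := Jvar (u n) (u k - u n) 1; rewrite scale1r addrC subrK.
  have Wkn : W (u k - u n).
    by rewrite addrC -scaleN1r; apply: WP; have [] := Hu k; have [] := Hu n.
  move=> Jk /(_ (Wu n _ _ Wkn)).
  have [_] := Hu n; have [_] := Hu k; rewrite {1}Jk.
  have sk : (1 / 2 ^+ k) ^+ 2 <= (e / 4) ^+ 2 :> R.
    by rewrite ler_pXn2r ?nnegrE ?ltW//; lra.
  have sn : (1 / 2 ^+ n) ^+ 2 <= (e / 4) ^+ 2 :> R.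
    by rewrite ler_pXn2r ?nnegrE ?ltW//; lra.
  have se : e ^+ 2 <= rip (u k - u n) (u k - u n).
    by rewrite -nrm_sqr ler_pXn2r ?nnegrE ?nrm_ge0// ltW.
  have : 0 < e ^+ 2 by rewrite exprn_gt0.
  by move: sk sn; rewrite exprMn; lra.
have [y uy] := cV cu.
have Re_y w : W w -> complex.Re (f w) = rip w y.
  move=> Ww; apply/eqP; rewrite -subr_eq0 -normr_le0.
  apply/ler_addgt0Pr => e e0; rewrite add0r.
  have w1 : 0 < 2 * (nrm w + 1) by have := nrm_ge0 ip w; lra.
  have [n1 H1] := uy _ (divr_gt0 e0 w1).
  have [n2 H2] := geometric_lt 1 (divr_gt0 e0 w1).
  have {H1} := H1 (maxn n1 n2) (leq_maxl _ _).
  have {H2} : 1 / 2 ^+ (maxn n1 n2) < e / (2 * (nrm w + 1)).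
    apply: le_lt_trans H2.
    rewrite ler_wpM2l// lef_pV2 ?posrE ?exprn_gt0// ler_eXn2l// ?ltr1n//.
    exact: leq_maxr.
  move: (maxn n1 n2) => n; rewrite !ltr_pdivlMr// => le2 le1.
  have -> : complex.Re (f w) - rip w y =
      rip (u n - y) w - (rip (u n) w - complex.Re (f w)).
    by rewrite ripDl ripNl (ripC _ w y); ring.
  apply: le_trans (ler_normB _ _) _.
  have := var n w Ww; have := ripCS ip (u n - y) w.
  have := nrm_ge0 ip (u n - y); have := d0 n.
  by move: le1 le2; lra.
exists y, u; split=> // [n|w Ww]; first by have [] := Hu n.
(* The real part of the identity at ['i *: w] is its imaginary part at [w]. *)
have Wi : W ('i%C *: w) by rewrite -[_ *: _]addr0; apply: WP.
apply: eq_complexP; first exact: Re_y.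
have f0 : f 0 = 0.
  have := fP 1 0 0; rewrite scaler0 addr0 mul1r => /eqP.
  by rewrite -subr_eq0 opprD addrA subrr sub0r oppr_eq0 => /eqP.
have fi : f ('i%C *: w) = 'i%C * f w by rewrite -[_ *: _]addr0 fP f0 addr0.
have := Re_y _ Wi; rewrite fi ReiM.
have -> : rip ('i%C *: w) y = - complex.Im (ip w y).
  by rewrite /rip -ReiM -linearZl_LR.
by move=> /oppr_inj.
Qed.

Lemma riesz (f : V -> R[i]) (M : R) :
  (forall a x y, f (a *: x + y) = a * f x + f y) ->
  (forall x, rnorm (f x) <= M * nrm x) ->
  exists y, forall x, f x = ip x y.
Proof.
move=> fP fM.
have [//|//|y [u [_ _ fy]]] := @riesz_subspace (fun=> True) f M _ _ fP fM.
by exists y => x; exact: fy.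
Qed.

(** On [W] the functional [ip^~ x] is represented by a limit [y] of points of [W]; then [x - y] is
    orthogonal to [W], hence zero. *)
Lemma dense_subspace (W : V -> Prop) : W 0 ->
  (forall a x y, W x -> W y -> W (a *: x + y)) ->
  (forall x, (forall w, W w -> ip w x = 0) -> x = 0) ->
  forall x, exists2 u, forall n, W (u n) & seq_lim nrm u x.
Proof.
move=> W0 WP W_orth x.
have [||y [u [Wu uy xy]]] := riesz_subspace (f := ip^~ x) (M := nrm x) W0 WP.
- by move=> a v w; rewrite ipP_l.
- by move=> v; rewrite mulrC ipCS.
exists u => //; suff -> : x = y by [].
by apply/subr0_eq/W_orth => w Ww; rewrite linearBr /= xy// subrr.
Qed.

End riesz.

(** * Square roots of positive operators *)

Definition linear_of (K : nzRingType) (U W : lmodType K) (f : U -> W)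
    (lf : linear f) : {linear U -> W} :=
  HB.pack f (GRing.isLinear.Build K U W *:%R f lf).

Section square_root.
Context {R : realType} {V : lmodType R[i]} (ip : {dot V for conjC}).
Hypothesis cV : seq_complete (nrm ip).
Local Notation rip := (rip ip).
Local Notation nrm := (nrm ip).

Section contraction.
Variable X : {linear V -> V}.
Hypothesis X_sym : forall x y, ip (X x) y = ip x (X y).
Hypothesis X_le1 : forall x, nrm (X x) <= nrm x.

(* Y = 1 - sqrt(1 - X) is the fixed point of Y = (X + Y^2) / 2. *)
Fixpoint sqrt_iter n : V -> V :=
  if n is m.+1 then
    fun x => (2^-1 : R)%:C *: (X x + sqrt_iter m (sqrt_iter m x))
  else fun=> 0.

(* Dominates the operator norms of the iterates and of their differences. *)
Fixpoint sqrt_iter_bound n : R :=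
  if n is m.+1 then 2^-1 * (1 + sqrt_iter_bound m ^+ 2) else 0.

Local Notation Y := sqrt_iter.
Local Notation y := sqrt_iter_bound.

Fact sqrt_iter_linear n : linear (Y n).
Proof.
elim: n => [|n IHn] a u v /=; first by rewrite scaler0 addr0.
by rewrite linearP !IHn addrACA -[a *: X u + _]scalerDr (scalerDr _ (a *: _)) !scalerA mulrC.
Qed.
HB.instance Definition _ n :=
  GRing.isLinear.Build R[i] V V *:%R (Y n) (sqrt_iter_linear n).

Lemma sqrt_iterB n u v : Y n (u - v) = Y n u - Y n v.
Proof. exact: linearB. Qed.

Lemma sqrt_iter_sym n u v : ip (Y n u) v = ip u (Y n v).
Proof.
elim: n u v => [|n IHn] u v /=; first by rewrite linear0l linear0r.
by rewrite ipZl ipZr conjC_real ipDl ipDr X_sym !IHn.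
Qed.

Lemma sqrt_iter_comm (Z : {linear V -> V}) : (forall u, Z (X u) = X (Z u)) ->
  forall n u, Z (Y n u) = Y n (Z u).
Proof.
move=> ZX; elim=> [|n IHn] u /=; first by rewrite linear0.
by rewrite linearZ linearD ZX !IHn.
Qed.

Lemma sqrt_iterC m n u : Y m (Y n u) = Y n (Y m u).
Proof.
by apply: sqrt_iter_comm => {}u; rewrite (sqrt_iter_comm (Z := X)).
Qed.

Lemma sqrt_iter_bound_itv n : 0 <= y n <= 1.
Proof. by elim: n => [|n /andP[? ?]] /=; rewrite ?lexx ?ler01//; nra. Qed.

Lemma sqrt_iter_boundS n : y n <= y n.+1.
Proof.
elim: n => [|n IHn] /=; first by rewrite expr0n addr0 mulr1 invr_ge0.
have /andP[? ?] := sqrt_iter_bound_itv n.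
have /andP[? ?] := sqrt_iter_bound_itv n.+1.
by rewrite ler_pM2l ?invr_gt0// lerD2l ler_pXn2r.
Qed.

Lemma nrm_half u : nrm ((2^-1 : R)%:C *: u) = 2^-1 * nrm u.
Proof. by rewrite (seminorm_nrm ip).2 ger0_norm ?invr_ge0. Qed.

Lemma sqrt_iter_le n u : nrm (Y n u) <= y n * nrm u.
Proof.
elim: n u => [|n IHn] u /=; first by rewrite mul0r (seminorm0 (seminorm_nrm ip)).
rewrite nrm_half -mulrA ler_pM2l ?invr_gt0//.
have := (seminorm_nrm ip).1 (X u) (Y n (Y n u)); have := X_le1 u.
have /andP[y0 _] := sqrt_iter_bound_itv n.
by have := IHn (Y n u); have := ler_wpM2l y0 (IHn u); lra.
Qed.

Lemma sqrt_iter_le1 n u : nrm (Y n u) <= nrm u.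
Proof.
apply: le_trans (sqrt_iter_le n u) _.
by have := nrm_ge0 ip u; have /andP[_ +] := sqrt_iter_bound_itv n; nra.
Qed.

(** As the iterates commute, [Y n.+2 - Y n.+1] is half of [(Y n.+1 + Y n) (Y n.+1 - Y n)]. The
    numbers [y n] satisfy the same identity, so they control the increments in norm. *)
Lemma sqrt_iter_distS n u : nrm (Y n.+1 u - Y n u) <= (y n.+1 - y n) * nrm u.
Proof.
elim: n u => [|n IHn] u.
  rewrite /= expr0n !subr0 /= !addr0 mulr1 nrm_half.
  by rewrite ler_pM2l ?invr_gt0.
have -> : Y n.+2 u - Y n.+1 u = (2^-1)%:C *:
    (Y n.+1 (Y n.+1 u - Y n u) + Y n (Y n.+1 u - Y n u)).
  rewrite [LHS](_ : _ = (2^-1)%:C *: (X u + Y n.+1 (Y n.+1 u)) -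
    (2^-1)%:C *: (X u + Y n (Y n u)))//.
  rewrite -scalerBr !sqrt_iterB (sqrt_iterC n.+1 n u) addrA subrK.
  by rewrite opprD addrACA subrr add0r.
rewrite nrm_half.
have -> : y n.+2 - y n.+1 = 2^-1 * ((y n.+1 + y n) * (y n.+1 - y n)).
  rewrite [LHS](_ : _ = 2^-1 * (1 + y n.+1 ^+ 2) - 2^-1 * (1 + y n ^+ 2))//.
  by ring.
rewrite -mulrA ler_pM2l ?invr_gt0//.
have := (seminorm_nrm ip).1 (Y n.+1 (Y n.+1 u - Y n u)) (Y n (Y n.+1 u - Y n u)).
have := sqrt_iter_le n.+1 (Y n.+1 u - Y n u).
have := sqrt_iter_le n (Y n.+1 u - Y n u).
have /andP[y0 _] := sqrt_iter_bound_itv n.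
have /andP[y1 _] := sqrt_iter_bound_itv n.+1.
by have := ler_wpM2l y0 (IHn u); have := ler_wpM2l y1 (IHn u); lra.
Qed.

Lemma sqrt_iter_dist m n u : (n <= m)%N ->
  nrm (Y m u - Y n u) <= (y m - y n) * nrm u.
Proof.
elim: m => [|m IHm].
  by rewrite leqn0 => /eqP->; rewrite !subrr mul0r (seminorm0 (seminorm_nrm ip)).
rewrite leq_eqVlt => /predU1P[->|].
  by rewrite !subrr mul0r (seminorm0 (seminorm_nrm ip)).
rewrite ltnS => /IHm le; have := sqrt_iter_distS m u.
have := seminorm_triangle (Y m u) (Y m.+1 u) (Y n u) (seminorm_nrm ip).
by move: le; lra.
Qed.

Lemma sqrt_iter_bound_homo m n : (n <= m)%N -> y n <= y m.
Proof.
elim: m => [|m IHm]; first by rewrite leqn0 => /eqP->.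
rewrite leq_eqVlt => /predU1P[->//|]; rewrite ltnS => /IHm.
by move/le_trans; apply; exact: sqrt_iter_boundS.
Qed.

(** The numbers [y n] approach their limit without a geometric rate; that they increase and are
    bounded by 1 is enough. *)
Lemma sqrt_iter_cauchy u : seq_cauchy nrm (Y ^~ u).
Proof.
have supy : has_sup (range y).
  split; first by exists (y 0%N), 0%N.
  by exists 1 => _ [n _ <-]; have /andP[] := sqrt_iter_bound_itv n.
move=> e e0; have u1 : 0 < nrm u + 1 by have := nrm_ge0 ip u; lra.
have [_ [n0 _ <-] lt] := sup_adherent (divr_gt0 e0 u1) supy.
have H m n : (n0 <= n)%N -> (n <= m)%N -> nrm (Y m u - Y n u) < e.
  move=> n0n nm; apply: le_lt_trans (sqrt_iter_dist u nm) _.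
  have ym : y m <= sup (range y) by apply: sup_upper_bound => //; exists m.
  have yn := sqrt_iter_bound_homo n0n.
  have : y m - y n < e / (nrm u + 1) by lra.
  rewrite ltr_pdivlMr//.
  by have := sqrt_iter_bound_homo nm; have := nrm_ge0 ip u; lra.
exists n0 => m n n0m n0n; have [nm|/ltnW mn] := leqP n m; first exact: H.
by rewrite seminormB ?H//; exact: seminorm_nrm.
Qed.

(** With [Z] the pointwise limit of the iterates and [S = 1 - Z], the equation [2 Z = X + Z^2] reads
    [S^2 = 1 - X], and [S] is positive because [Z] is a contraction. *)
Lemma contraction_sqrt : exists S : {linear V -> V},
  [/\ forall u v, ip (S u) v = ip u (S v), forall u, 0 <= rip (S u) u &
    forall u, S (S u) = u - X u].
Proof.
have sN := seminorm_nrm ip.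
have /choice[Z HZ] u := cV (sqrt_iter_cauchy u).
have uniq v k l : seq_lim nrm v k -> seq_lim nrm v l -> k = l.
  by apply: seq_lim_unique; [exact: sN|exact: nrm_eq0].
have ZP : linear Z.
  move=> a u v; apply: uniq (HZ _) _.
  have := seq_limP (a := a) (M := rnorm a) sN _ (HZ u) (HZ v).
  move=> /(_ (fun x => ltac:(by rewrite nrmZ))) H e e0.
  by have [n0 Hn0] := H e e0; exists n0 => n /Hn0; rewrite sqrt_iter_linear.
have Z_sym u v : ip (Z u) v = ip u (Z v).
  by apply: seq_lim_ip (HZ u) (HZ v) _ => n; exact: sqrt_iter_sym.
have Z_le u : nrm (Z u) <= nrm u.
  apply/ler_addgt0Pr => e e0; have [n Hn] := HZ u e e0.
  have := Hn n (leqnn n); have := sqrt_iter_le1 n u.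
  have := seminorm_triangle (Y n u) (Z u) 0 sN.
  by rewrite !subr0 (seminormB (Z u) (Y n u) sN); lra.
have ZE u : Z u = (2^-1)%:C *: (X u + Z (Z u)).
  apply: (uniq (fun n => Y n.+1 u)).
    move=> e e0; have [n0 Hn0] := HZ u e e0.
    by exists n0 => n n0n; apply: Hn0; exact: leqW.
  move=> e e0; have e2 : 0 < e / 2 by lra.
  (* [Y n (Y n u)] is compared with [Y n (Z u)], at no more cost than [Y n u - Z u] since [Y n] is a
     contraction. *)
  have [n1 H1] := HZ u _ e2; have [n2 H2] := HZ (Z u) _ e2.
  exists (maxn n1 n2) => n; rewrite geq_max => /andP[/H1 lt1 /H2 lt2].
  rewrite -scalerBr nrm_half opprD addrACA subrr add0r.
  have := seminorm_triangle (Y n (Z u)) (Y n (Y n u)) (Z (Z u)) sN.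
  rewrite -sqrt_iterB; have := sqrt_iter_le1 n (Y n u - Z u).
  by have := nrm_ge0 ip (Y n (Y n u) - Z (Z u)); lra.
have SP : linear (fun u => u - Z u).
  by move=> a u v; rewrite ZP opprD addrACA scalerBr.
exists (linear_of SP); split=> /= [u v|u|u].
- by rewrite ipBl ipBr Z_sym.
- rewrite ripDl ripNl -nrm_sqr; have := le_trans (ler_norm _) (ripCS ip (Z u) u).
  by have := Z_le u; have := nrm_ge0 ip u; nra.
- have ZB : Z (u - Z u) = Z u - Z (Z u) by rewrite addrC -scaleN1r ZP scaleN1r addrC.
  have Z2 : Z u + Z u = X u + Z (Z u).
    rewrite {1 2}(ZE u) -scalerDl -rmorphD/= (_ : 2^-1 + 2^-1 = 1) ?scale1r//.
    by lra.
  by rewrite ZB opprB -addrA [- Z u + _]addrCA -opprD Z2 opprD [Z (Z u) + _]addrCA subrr addr0.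
Qed.
End contraction.

(** Cauchy-Schwarz for the semi-inner product [<K u, v>] at [u] and [K u] bounds the fourth power of
    [nrm (K u)] by [<K u, u> <K (K u), K u>]. This turns a bound on the form into one on the
    operator. *)
Lemma sym_pos_contraction (K : {linear V -> V}) :
  (forall u v, ip (K u) v = ip u (K v)) -> (forall u, 0 <= rip (K u) u) ->
  (forall u, rip (K u) u <= rip u u) -> forall u, nrm (K u) <= nrm u.
Proof.
move=> K_sym K_ge0 K_le u.
have : rip (K u) (K u) ^+ 2 <= rip (K u) u * rip (K (K u)) (K u).
  apply: discriminant_le => // t.
  have := K_ge0 (u + t%:C *: K u); rewrite linearD linearZ /=.
  rewrite !(ripDl, ripDr) !(ripZl, ripZr).
  have -> : rip (K (K u)) u = rip (K u) (K u) by rewrite /rip K_sym.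
  by lra.
have := K_le u; have := K_le (K u); have := K_ge0 u; have := K_ge0 (K u).
rewrite -!nrm_sqr => ? ? le1 le2 le.
have : (nrm (K u) ^+ 2) ^+ 2 <= nrm u ^+ 2 * nrm (K u) ^+ 2.
  by apply: le_trans le _; apply: ler_pM.
have := nrm_ge0 ip (K u); rewrite le_eqVlt => /predU1P[<- _|n0].
  exact: nrm_ge0.
by rewrite expr2 ler_pM2r ?exprn_gt0// ler_pXn2r// nnegrE nrm_ge0.
Qed.

(** [X = 1 - K / M] lies between 0 and 1 as a form, hence is a contraction; the root of
    [1 - X = K / M] is then scaled by the root of [M]. *)
Lemma positive_sqrt (K : {linear V -> V}) (M : R) : 0 < M ->
  (forall u, nrm (K u) <= M * nrm u) ->
  (forall u v, ip (K u) v = ip u (K v)) -> (forall u, 0 <= rip (K u) u) ->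
  exists S : {linear V -> V}, [/\ forall u v, ip (S u) v = ip u (S v),
    forall u, 0 <= rip (S u) u & forall u, S (S u) = K u].
Proof.
move=> M0 KM K_sym K_ge0.
have XP : linear (fun u => u - M^-1%:C *: K u).
  move=> a u v; rewrite linearP (scalerDr _ (a *: _)) opprD addrACA.
  by rewrite scalerBr !scalerA mulrC.
have K_le u : rip (K u) u <= M * rip u u.
  apply: le_trans (ler_norm _) (le_trans (ripCS _ _ _) _).
  by rewrite -nrm_sqr expr2 mulrA ler_wpM2r ?nrm_ge0.
have Mi : M^-1 * M = 1 by rewrite mulVf ?gt_eqF.
have Mi0 : 0 < M^-1 by rewrite invr_gt0.
have [||S [S_sym S_ge0 SS]] := @contraction_sqrt (linear_of XP).
- by move=> u v; rewrite /= ipBl ipBr ipZl ipZr conjC_real K_sym.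
- apply: sym_pos_contraction => [u v|u|u] /=.
  + by rewrite ipBl ipBr ipZl ipZr conjC_real K_sym.
  + rewrite ripDl ripNl ripZl subr_ge0.
    by have := ler_wpM2l (ltW Mi0) (K_le u); rewrite mulrA Mi mul1r.
  + rewrite ripDl ripNl ripZl gerBl.
    by apply: mulr_ge0 => //; exact: ltW.
have TP : linear (fun u => (Num.sqrt M)%:C *: S u).
  by move=> a u v; rewrite linearP (scalerDr _ (a *: _)) !scalerA mulrC.
exists (linear_of TP); split=> /= [u v|u|u].
- by rewrite ipZl ipZr conjC_real S_sym.
- by rewrite ripZl mulr_ge0 ?sqrtr_ge0.
- rewrite linearZ SS /= scalerA -rmorphM/= -expr2 sqr_sqrtr ?ltW//.
  by rewrite opprB addrC subrK scalerA -rmorphM/= mulrC Mi scale1r.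
Qed.
End square_root.

(** * Operators between two Hilbert spaces *)

Section hilbert_pairs.
Context {R : realType} {V E : lmodType R[i]}.
Context (ip : {dot V for conjC}) (ipE : {dot E for conjC}).
Hypothesis cE : seq_complete (nrm ipE).

(** Used across two spaces for the adjoint of the inclusion of [D] in [H], and inside [H] for [Q].
    Riesz is applied to the conjugate of [g x], which is linear. *)
Lemma bounded_form_operator (g : V -> E -> R[i]) (b : R) :
  (forall a x x' y, g (a *: x + x') y = a * g x y + g x' y) ->
  (forall a x y y', g x (a *: y + y') = conjC a * g x y + g x y') ->
  0 <= b -> (forall x y, rnorm (g x y) <= b * nrm ip x * nrm ipE y) ->
  exists Q : {linear V -> E}, (forall x y, g x y = ipE (Q x) y) /\
    (forall x, nrm ipE (Q x) <= b * nrm ip x).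
Proof.
move=> gl gr b0 gb.
have /choice[Q HQ] x : exists q, forall y, g x y = ipE q y.
  have [||q Hq] := riesz cE (f := fun y => conjC (g x y)) (M := b * nrm ip x).
  - by move=> a y y'; rewrite gr rmorphD rmorphM; congr (_ * _ + _); exact: conjCK.
  - by move=> y; rewrite rnorm_conjC.
  by exists q => y; rewrite ipC -Hq conjCK.
have QP : linear Q.
  by move=> a x x'; apply: (@ip_eq _ _ ipE) => y; rewrite ipP_l -!HQ gl.
exists (linear_of QP); split=> //= x.
have := nrm_ge0 ipE (Q x); rewrite le_eqVlt => /predU1P[<-|q0].
  by rewrite mulr_ge0 ?nrm_ge0.
rewrite -(ler_pM2r q0) -expr2 nrm_sqr.
by apply: le_trans (gb x (Q x)); rewrite HQ Re_le_rnorm.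
Qed.

Hypothesis cV : seq_complete (nrm ip).

(* With K the adjoint of iota and S the square root of iota K, S x |-> K x is
   isometric between dense subspaces; its closure has iota as composite S. *)
Lemma sqrt_range (iota : {linear E -> V}) (alpha : R) : 0 < alpha ->
  injective iota -> (forall xi, nrm ip (iota xi) <= alpha * nrm ipE xi) ->
  (forall x, (forall xi, ip (iota xi) x = 0) -> x = 0) ->
  exists S : {linear V -> V}, [/\ forall x y, ip (S x) y = ip x (S y),
    forall x, 0 <= rip ip (S x) x,
    forall x, exists2 xi, iota xi = S x & nrm ipE xi = nrm ip x &
    forall xi, exists x, S x = iota xi].
Proof.
move=> alpha0 iotaI iota_le iota_dense.
have sV := seminorm_nrm ip; have sE := seminorm_nrm ipE.
have [||||K [HK K_le]] :=
    bounded_form_operator (g := fun x xi => ip x (iota xi)) (b := alpha).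
- by move=> a x x' xi; rewrite ipP_l.
- by move=> a x xi xi'; rewrite linearP ipP_r.
- exact: ltW.
- move=> x xi; apply: le_trans (ipCS _ _ _) _.
  by have := iota_le xi; have := nrm_ge0 ip x; nra.
have HK' x xi : ip (iota xi) x = ipE xi (K x) by rewrite ipC HK -ipC.
have LP : linear (iota \o K) by move=> a x y; rewrite /= !linearP.
have [||||S [S_sym S_ge0 SS]] := @positive_sqrt _ _ ip cV (linear_of LP) (alpha * alpha).
- exact: mulr_gt0.
- move=> x; apply: le_trans (iota_le _) _; rewrite -mulrA.
  by rewrite ler_pM2l ?K_le.
- by move=> x y; rewrite /= HK' HK.
- by move=> x; rewrite /rip /= HK' -/(rip ipE _ _) rip_ge0.
have {}SS x : S (S x) = iota (K x) by rewrite SS.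
(* This is the isometry [S x |-> K x]: both squared norms are the product of [x] with
   [iota (K x)]. *)
have nS x : nrm ip (S x) = nrm ipE (K x).
  by rewrite /nrm /rip S_sym SS HK.
have S_le x : nrm ip (S x) <= alpha * nrm ip x by rewrite nS K_le.
have S_inj x : S x = 0 -> x = 0.
  move=> Sx; apply: iota_dense => xi; rewrite HK' (_ : K x = 0) ?linear0r//.
  by apply: (nrm_eq0 (ip := ipE)); rewrite -nS Sx (seminorm0 sV).
(* The orthogonal complement of the range of [S] is its kernel by symmetry; below, that of the range
   of [K] is the kernel of [iota]. *)
have S_dense x : exists v, seq_lim (nrm ip) (S \o v) x.
  have [|||u Wu ux] := dense_subspace cV (W := fun y => exists v, y = S v) _ _ _ x.
  - by exists 0; rewrite linear0.
  - by move=> a _ _ [v ->] [w ->]; exists (a *: v + w); rewrite linearP.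
  - move=> y yS; apply/S_inj/(ip_eqr (ip := ip)) => z.
    by rewrite -S_sym linear0r yS//; exists z.
  have /choice[v Hv] := Wu; exists v => e /ux[n0 Hn0].
  by exists n0 => n /Hn0; rewrite /= -Hv.
have K_dense xi : exists v, seq_lim (nrm ipE) (K \o v) xi.
  have [|||u Wu ux] := dense_subspace cE (W := fun y => exists v, y = K v) _ _ _ xi.
  - by exists 0; rewrite linear0.
  - by move=> a _ _ [v ->] [w ->]; exists (a *: v + w); rewrite linearP.
  - move=> y yK; apply/iotaI; rewrite linear0; apply/(ip_eqr (ip := ip)) => z.
    by rewrite linear0r HK yK//; exists z.
  have /choice[v Hv] := Wu; exists v => e /ux[n0 Hn0].
  by exists n0 => n /Hn0; rewrite /= -Hv.
(* Both sides are the limit of [S (S (v n)) = iota (K (v n))]. *)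
have SK_lim v x xi : seq_lim (nrm ip) (S \o v) x ->
    seq_lim (nrm ipE) (K \o v) xi -> S x = iota xi.
  move=> Sv Kv; apply: (seq_lim_unique (p := nrm ip) (u := S \o (S \o v))) => //.
  - exact: nrm_eq0.
  - apply: (seq_lim_bounded (M := alpha) sV sV Sv) => n.
    by rewrite /= -linearB S_le.
  - apply: (seq_lim_bounded (M := alpha) sV sE Kv) => n.
    by rewrite /= SS -linearB iota_le.
(* By the isometry [S \o v] is Cauchy exactly when [K \o v] is: one direction puts the range of [S]
   inside that of [iota], the other gives the converse. *)
exists S; split=> // [x|xi].
  have [v Sv] := S_dense x.
  have [xi Kv] : exists xi, seq_lim (nrm ipE) (K \o v) xi.
    apply: cE => e e0; have [n0 Hn0] := seq_lim_cauchy sV Sv e0.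
    by exists n0 => m n mn0 /(Hn0 m _ mn0); rewrite /= -!linearB nS.
  exists xi; first by rewrite (SK_lim v x xi).
  apply/eqP; rewrite eq_le; apply/andP; split.
    by apply: seq_lim_seminorm_le Kv Sv _ => // n; rewrite /= nS.
  by apply: seq_lim_seminorm_le Sv Kv _ => // n; rewrite /= nS.
have [v Kv] := K_dense xi.
have [x Sv] : exists x, seq_lim (nrm ip) (S \o v) x.
  apply: cV => e e0; have [n0 Hn0] := seq_lim_cauchy sE Kv e0.
  by exists n0 => m n mn0 /(Hn0 m _ mn0); rewrite /= -!linearB nS.
by exists x; exact: SK_lim Sv Kv.
Qed.

End hilbert_pairs.

(** * Real bounds and reflexivity of Hilbert spaces *)

Section bounds.
Context {R : realType}.

Lemma lec_Re (x y : R[i]) : x <= y -> complex.Re x <= complex.Re y.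
Proof. by rewrite lecE => /andP[]. Qed.

Lemma Re_mul_real (x : R[i]) (c : R) : complex.Re (x * c%:C) = complex.Re x * c.
Proof. by case: x => a b /=; rewrite mulr0 subr0. Qed.

Lemma gtc0_Re (x : R[i]) : 0 < x -> 0 < complex.Re x /\ x = (complex.Re x)%:C.
Proof.
move=> x0; have xE : x = (complex.Re x)%:C by rewrite RRe_real// gtr0_real.
by split=> //; rewrite -ltcR -xE.
Qed.

Lemma bounded_mapP (E F : normedModType R[i]) (f : E -> F) :
  bounded_map f <->
  exists2 M : R, 0 < M & forall x, rnorm (f x) <= M * rnorm x.
Proof.
split=> [[M fM]|[M M0 fM]]; last first.
  by exists M%:C => x; rewrite !rnormE -rmorphM lecR.
exists (`|complex.Re M| + 1) => [|x]; first by rewrite ltr_wpDl.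
have := lec_Re (fM x); rewrite [`|x|]rnormE Re_mul_real => /le_trans; apply.
rewrite ler_wpM2r ?rnorm_ge0//.
by have := ler_norm (complex.Re M); lra.
Qed.

Lemma nrm_normed (E : normedModType R[i]) (ip : {dot E for conjC}) :
  (forall x : E, `|x| ^+ 2 = ip x x) -> nrm ip = @rnorm _ E.
Proof.
move=> ip_norm; apply/funext => x; apply: complexI.
by rewrite -rnormE (nrm_rnorm (ip := ip) (N := normr)).
Qed.

(** Riesz twice: every functional is some [f y], and since [f] is antilinear the conjugate of
    [Phi (f y)] is linear in [y], so it is represented by the required point. *)
Lemma hilbert_reflexive (E : normedModType R[i]) (ip : {dot E for conjC}) :
  (forall x : E, `|x| ^+ 2 = ip x x) -> complete_space E -> reflexive_space E.
Proof.
move=> ip_norm /complete_space_seq; have nE := nrm_normed ip_norm.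
rewrite -nE => cE Phi.
have riesz_dual y : (fun x => ip x y : R[i]^o) \in @dual_pred R E.
  apply/asboolP; split=> [a x x'|]; first by rewrite ipP_l.
  apply/bounded_mapP; exists (nrm ip y + 1) => [|x].
    by rewrite ltr_wpDl// nrm_ge0.
  apply: le_trans (ipCS ip x y) _; rewrite -nE.
  by have := nrm_ge0 ip x; lra.
pose f y : dual E := Dual (riesz_dual y).
have fP a y z : f (a *: y + z) = conjC a *: f y + f z.
  by apply/val_inj/funext => x; rewrite /= ipP_r.
have f_le y : rnorm (f y) <= nrm ip y.
  rewrite -lecR -rnormE; apply: dual_norm_le => [|x]; first exact: nrm_ge0.
  by rewrite !rnormE -rmorphM lecR -nE mulrC ipCS.
have /asboolP[PhiP /bounded_mapP[K K0 PhiK]] := valP Phi.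
have [||x Hx] := riesz cE (f := fun y => conjC (Phi (f y))) (M := K).
- move=> a y z; rewrite fP PhiP rmorphD rmorphM; congr (_ * _ + _).
  exact: conjCK.
- move=> y; rewrite rnorm_conjC; apply: le_trans (PhiK _) _.
  by rewrite ler_pM2l.
exists x => g.
have /asboolP[gP /bounded_mapP[M M0 gM]] := valP g.
have [||y Hy] := riesz cE (f := g) (M := M).
- by move=> a u v; rewrite gP.
- by move=> u; rewrite nE; exact: gM.
have -> : g = f y by apply/val_inj/funext => u; exact: Hy.
by rewrite /= ipC -Hx conjCK.
Qed.

End bounds.

(** * Representation of q-closed forms *)

Section representation.
Context {R : realType} {H : completeNormedModType R[i]}.
Context (ip : {dot H for conjC}).
Hypothesis ip_norm : forall x : H, `|x| ^+ 2 = ip x x.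
Context {P : {pred H}} {D : subLmodType P}.
Hypothesis denseD : dense [set x | x \in P].
Implicit Types (Omega : {sesquilinear D}) (A : {linear D -> H}).

Definition represented Omega A (Q : {linear H -> H}) :=
  [/\ positive_op ip A, self_adjoint ip A, resolvent_set A 0, bounded_map Q &
    forall xi eta : D, Omega xi eta = ip (Q (A xi)) (A eta)].

Let nH : nrm ip = @rnorm _ H.
Proof. exact: nrm_normed. Qed.

Let cH : seq_complete (nrm ip).
Proof. by rewrite nH; apply: complete_space_seq => F FF; exact: cauchy_cvg. Qed.

(** For nonzero [x], a point [y] of the domain closer to [x] than 0 is would give
    [|x|^2 = <x - y, x> < |x|^2]. *)
Lemma dense_orthogonal (x : H) : (forall xi : D, ip (\val xi) x = 0) -> x = 0.
Proof.
move=> xD; apply: (nrm_eq0 (ip := ip)); apply/eqP.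
rewrite eq_le nrm_ge0 andbT leNgt; apply/negP => x0.
have x0' : 0 < (nrm ip x)%:C by rewrite ltcR.
have [||y [/= xy Py]] := @denseD (ball x (nrm ip x)%:C).
- by exists x; exact: ballxx.
- exact: ball_open.
have := xD (Sub y Py); rewrite SubK => yx.
have : nrm ip (x - y) < nrm ip x.
  by move: xy; rewrite -ball_normE /ball_/= rnormE -nH ltcR.
have : nrm ip x ^+ 2 <= nrm ip (x - y) * nrm ip x.
  apply: le_trans (ler_norm _) _; rewrite nrm_sqr.
  have -> : rip ip x x = rip ip (x - y) x by rewrite /rip ipBl yx subr0.
  exact: ripCS.
by rewrite expr2 ler_pM2r// leNgt => /negP.
Qed.

(** Nonnegativity in [R[i]] includes being real, which comes from symmetry. *)
Lemma sym_ip_ge0 (S : H -> H) x :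
  ip (S x) x = ip x (S x) -> 0 <= rip ip (S x) x -> 0 <= ip (S x) x.
Proof.
move=> Sx; rewrite /rip lecE => ->; rewrite andbT.
have := f_equal (@complex.Im R) (etrans Sx (ipC ip x (S x))).
by case: (ip (S x) x) => a b /=; lra.
Qed.

(** [A] inverts the operator [S] of [sqrt_range], and [J] is [S] with values in [D]. As [J] carries
    [H] isometrically onto [D] normed by [N], [Omega (J x) (J y)] is a bounded form on [H]; [Q] is
    its operator. *)
Lemma q_closed_inner_represented Omega :
  q_closed_inner Omega -> exists A Q, represented Omega A Q.
Proof.
move=> [ipD [N [N_ip [[alpha alpha0 N_alpha] cN _ [beta beta0 N_beta]]]]].
have N_ge0 xi : 0 <= N xi by exact: (normr_ge0 (xi : normed_by N)).
have NE xi : N xi = (nrm ipD xi)%:C by exact: nrm_rnorm.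
have nD : nrm ipD = @rnorm _ (normed_by N).
  by apply/funext => xi; apply: complexI; rewrite -NE -rnormE.
have cD : seq_complete (nrm ipD) by rewrite nD; exact: (complete_space_seq cN).
have [a0 aE] := gtc0_Re alpha0; have [b0 bE] := gtc0_Re beta0.
have val_le (xi : D) : nrm ip (\val xi) <= complex.Re alpha * nrm ipD xi.
  have := N_alpha xi; rewrite NE aE -rmorphM rnormE lecR.
  by rewrite nH.
have Omega_le xi eta :
    rnorm (Omega xi eta) <= complex.Re beta * nrm ipD xi * nrm ipD eta.
  by have := N_beta xi eta; rewrite !NE bE -!rmorphM rnormE lecR.
pose iota : {linear D -> H} := \val.
have [||S [S_sym S_ge0 SD DS]] := sqrt_range (iota := iota) cD cH a0 _ val_le _.
- exact: val_inj.
- exact: dense_orthogonal.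
have S_inj x : S x = 0 -> x = 0.
  have [xi xiS nxi] := SD x; move=> Sx; apply: (nrm_eq0 (ip := ip)).
  rewrite -nxi (_ : xi = 0) ?(seminorm0 (seminorm_nrm ipD))//.
  by apply: val_inj; rewrite [LHS]xiS Sx linear0.
have SI x y : S x = S y -> x = y.
  by move=> Sxy; apply/subr0_eq/S_inj; rewrite linearB Sxy subrr.
have /choice[A SA] := DS.
have AP : linear A.
  by move=> a xi eta; apply: SI; rewrite linearP !SA linearP.
have /choice[J HJ] x : exists xi, iota xi = S x /\ nrm ipD xi = nrm ip x.
  by have [xi ? ?] := SD x; exists xi.
have JP : linear J.
  move=> a x y; apply: val_inj; rewrite -[LHS]/(iota _) -[RHS]/(iota _).
  by rewrite linearP !(HJ _).1 linearP.
have JA xi : J (A xi) = xi by apply: val_inj; rewrite -[LHS]/(iota _) (HJ _).1 SA.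
have AJ x : A (J x) = x by apply: SI; rewrite SA (HJ _).1.
have [||||Q [HQ Q_le]] := bounded_form_operator (ip := ip) (ipE := ip) cH
    (g := fun x y => Omega (J x) (J y)) (b := complex.Re beta).
- by move=> a x y z; rewrite JP linearDl linearZl_LR.
- by move=> a x y z; rewrite JP linearDr linearZr_LR.
- exact: ltW.
- by move=> x y; have := Omega_le (J x) (J y); rewrite !(HJ _).2.
exists (linear_of AP), Q; split => /=.
- move=> xi; rewrite -[\val xi]/(iota xi) -SA -S_sym.
  exact: sym_ip_ge0.
- apply/seteqP; split=> [_ [xi _ <-] eta|[u v] /= uv].
    by rewrite /= -[\val xi]/(iota xi) -[\val eta]/(iota eta) -!SA S_sym.
  (* The adjoint relation tested on [J z] gives [u = S v], which lies in the domain and is sent to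
     [v] by [A]. *)
  have Suv : S v = u.
    apply: (ip_eqr (ip := ip)) => z; rewrite -S_sym -(HJ z).1 -uv.
    by rewrite /= AJ.
  exists (J v) => //=.
  by rewrite AJ -[\val _]/(iota _) (HJ v).1 Suv.
- exists S; split=> [|xi|x].
  + apply/bounded_mapP; exists (complex.Re alpha) => // x.
    by rewrite -nH -(HJ x).1 -(HJ x).2 val_le.
  + by rewrite scale0r subr0 /= SA.
  + exists (J x); first exact: (HJ x).1.
    by rewrite scale0r subr0 /= AJ.
- by apply/bounded_mapP; exists (complex.Re beta) => // x; rewrite -nH.
- by move=> xi eta; rewrite -HQ !JA.
Qed.

End representation.

(** * From the representation back to the form: graph norm, P(Omega), associated operator *)

Section pullback.
Context {R : realType} {V W : lmodType R[i]} (ip : {dot V for conjC}).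
Context (f : {linear W -> V}) (f_inj : injective f).

(** Taken at [f = A], this is the inner product of the graph norm. *)
Definition pullback_form (x y : W) : R[i] := ip (f x) (f y).

Fact pullback_form_bilinear :
  bilinear_for *%R (conjC \; *%R) pullback_form.
Proof. by split=> u a x y; rewrite /pullback_form linearP ?ipP_l ?ipP_r. Qed.

Fact pullback_form_hermitian x y :
  pullback_form x y = (-1) ^+ false * conjC (pullback_form y x).
Proof. by rewrite expr0 mul1r /pullback_form ipC. Qed.

Fact pullback_form_gt0 x : x != 0 -> 0 < pullback_form x x.
Proof.
rewrite /pullback_form dnorm_gt0; apply: contraNneq => fx.
by apply/eqP/f_inj; rewrite fx linear0.
Qed.

Definition pullback_dot : {dot W for conjC} := HB.pack pullback_form
  (bilinear_isBilinear.Build R[i] W W R[i] *%R (conjC \; *%R)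
     pullback_form pullback_form_bilinear)
  (isHermitianSesquilinear.Build R[i] W false conjC
     pullback_form pullback_form_hermitian)
  (isDotProduct.Build R[i] W pullback_form pullback_form_gt0).

End pullback.

Section operator.
Context {R : realType} {H : completeNormedModType R[i]}.
Context (ip : {dot H for conjC}).
Hypothesis ip_norm : forall x : H, `|x| ^+ 2 = ip x x.
Context {P : {pred H}} {D : subLmodType P}.
Implicit Types (Omega : {sesquilinear D}) (A : {linear D -> H}).

Let nH : nrm ip = @rnorm _ H.
Proof. exact: nrm_normed. Qed.

Let cH : seq_complete (nrm ip).
Proof. by rewrite nH; apply: complete_space_seq => F FF; exact: cauchy_cvg. Qed.

(** Both norms dominate that of [H], so limits of one sequence in the two norms agree in [H]: this
    is the closedness that [closed_graph] asks for. *)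
Lemma norm_on_equiv (N1 N2 : norm_on D) (a1 a2 : R[i]) :
  0 < a1 -> 0 < a2 ->
  (forall xi, `|\val xi| <= a1 * N1 xi) -> (forall xi, `|\val xi| <= a2 * N2 xi) ->
  complete_space (normed_by N1) -> complete_space (normed_by N2) ->
  exists2 C : R, 0 < C & forall xi, N1 xi <= C%:C * N2 xi.
Proof.
move=> /gtc0_Re[a10 ->] /gtc0_Re[a20 ->] le1 le2 c1 c2.
have E1 (xi : D) : N1 xi = (rnorm (xi : normed_by N1))%:C.
  exact: (rnormE (xi : normed_by N1)).
have E2 (xi : D) : N2 xi = (rnorm (xi : normed_by N2))%:C.
  exact: (rnormE (xi : normed_by N2)).
have [|C C0 HC] := @closed_graph R D (@rnorm _ (normed_by N1)) (@rnorm _ (normed_by N2))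
    (seminorm_rnorm (normed_by N1)) (seminorm_rnorm (normed_by N2))
    (complete_space_seq c1) (complete_space_seq c2)
    (@rnorm_eq0 _ (normed_by N2)).
  move=> u x y ux uy; apply: val_inj.
  apply: (seq_lim_unique (p := @rnorm _ H) (u := fun n => \val (u n))).
  - exact: seminorm_rnorm.
  - exact: rnorm_eq0.
  - apply: (seq_lim_bounded (M := complex.Re a1) _ _ ux) => [||n].
    + exact: seminorm_rnorm.
    + exact: (seminorm_rnorm (normed_by N1)).
    + by have := le1 (u n - x); rewrite E1 rnormE -rmorphM lecR raddfB.
  - apply: (seq_lim_bounded (M := complex.Re a2) _ _ uy) => [||n].
    + exact: seminorm_rnorm.
    + exact: (seminorm_rnorm (normed_by N2)).
    + by have := le2 (u n - y); rewrite E2 rnormE -rmorphM lecR raddfB.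
by exists C => // xi; rewrite E1 E2 -rmorphM lecR.
Qed.

(** The resolvent at 0 is [op_inv A] followed by the inclusion in [H], which gives boundedness;
    symmetry comes from the inclusion of the graph of [A] in that of its adjoint. *)
Lemma op_invP A : self_adjoint ip A -> resolvent_set A 0 ->
  [/\ cancel (op_inv A) A, cancel A (op_inv A), linear (op_inv A),
    forall x y, ip (\val (op_inv A x)) y = ip x (\val (op_inv A y)) &
    exists2 M : R, 0 < M & forall x, rnorm (\val (op_inv A x)) <= M * rnorm x].
Proof.
move=> A_sa [S [S_bd SA AS]].
have {}SA xi : S (A xi) = \val xi by rewrite -SA scale0r subr0.
have {}AS x : exists2 xi, \val xi = S x & A xi = x.
  by have [xi ? <-] := AS x; exists xi => //; rewrite scale0r subr0.
have AI : injective A by move=> xi eta e; apply: val_inj; rewrite -!SA e.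
have AK : cancel A (op_inv A).
  by move=> xi; rewrite /op_inv pinvKV ?inE// => ? ? _ _; exact: AI.
have KA : cancel (op_inv A) A by move=> x; have [xi _ <-] := AS x; rewrite AK.
have VS x : \val (op_inv A x) = S x by rewrite -SA KA.
split=> //.
- by move=> a x y; apply: AI; rewrite linearP !KA.
- move=> x y; have := A_sa; rewrite /self_adjoint => /seteqP[+ _].
  move=> /(_ (\val (op_inv A y), A (op_inv A y)) (ex_intro2 _ _ _ I erefl)).
  by move=> /(_ (op_inv A x)); rewrite /= !KA => ->.
- have /bounded_mapP[M M0 S_le] := S_bd.
  by exists M => // x; rewrite VS.
Qed.

(** [A] is an isometry onto [H], so it matches balls with balls and carries Cauchy filters to
    convergent ones. *)
Lemma graph_norm_complete A (N : norm_on D) : (forall xi, N xi = `|A xi|) ->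
  (forall x, exists xi, A xi = x) -> complete_space (normed_by N).
Proof.
move=> NA A_surj F FF /cauchyP cF.
have AB (xi eta : normed_by N) (e : R[i]) : ball (A xi) e (A eta) = ball xi e eta.
  by rewrite -!ball_normE /ball_/= -linearB -NA.
have AB1 (xi eta : normed_by N) e : ball xi e eta -> ball (A xi) e (A eta).
  by rewrite AB.
have AB2 (xi eta : normed_by N) e : ball (A xi) e (A eta) -> ball xi e eta.
  by rewrite AB.
have cAF : cauchy (A @ F).
  apply/cauchyP => e /cF[xi Fxi]; exists (A xi).
  exact: (filterS (fun eta => AB1 xi eta e) Fxi).
have := cauchy_cvg _ cAF; have [xi <-] := A_surj (lim (A @ F)) => AF.
apply/cvg_ex; exists (xi : normed_by N); apply/cvg_ballP => e e0.
have AFe : (A @ F) (ball (A xi) e) by apply: AF; exact: nbhsx_ballx.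
exact: (filterS (fun eta => AB2 xi eta e) AFe).
Qed.

(** The constants are operator bounds: alpha for the inverse of [A], beta for [Q]. The formula for
    [N] is exported for the comparison in [frakP_bijective]. *)
Lemma represented_q_closed Omega A (Q : {linear H -> H}) :
  represented ip Omega A Q -> exists (ipA : {dot D for conjC}) (N : norm_on D),
    [/\ forall xi, N xi = `|A xi|, forall xi, N xi ^+ 2 = ipA xi xi &
      q_closed N Omega].
Proof.
move=> [_ A_sa A_res /bounded_mapP[K K0 Q_le] HO].
have [KA AK _ _ [M M0 J_le]] := op_invP A_sa A_res.
have N_D xi eta : `|A (xi + eta)| <= `|A xi| + `|A eta|.
  by rewrite linearD ler_normD.
have N_Z a xi : `|A (a *: xi)| = `|a| * `|A xi| by rewrite linearZ normrZ.
have N_0 xi : `|A xi| = 0 -> xi = 0.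
  by move=> /normr0_eq0 Axi; rewrite -[xi]AK Axi -(linear0 A) AK.
pose N := NormOn N_D N_Z N_0.
have N_ip (xi : D) : `|A xi| ^+ 2 = pullback_dot ip (can_inj AK) xi xi.
  exact: ip_norm.
have cN : complete_space (normed_by N).
  by apply: (graph_norm_complete (A := A)) => // x; exists (op_inv A x).
exists (pullback_dot ip (can_inj AK)), N; split=> //; split=> //.
- exists M%:C => [|xi]; first by rewrite ltcR.
  by rewrite /= !rnormE -rmorphM lecR -{1}[xi]AK.
- exact: (hilbert_reflexive (E := normed_by N) (ip := pullback_dot ip (can_inj AK))).
- exists K%:C => [|xi eta]; first by rewrite ltcR.
  rewrite HO /= !rnormE -!rmorphM lecR; apply: le_trans (ipCS _ _ _) _.
  by rewrite nH ler_wpM2r// rnorm_ge0.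
Qed.

Lemma frakP_bijective Omega A (Q : {linear H -> H}) (N : norm_on D)
    (Ups : {sesquilinear H}) (B : {linear H -> H}) :
  represented ip Omega A Q -> q_closed N Omega -> bounded_form Ups ->
  (forall xi eta : H, Ups xi eta = ip (B xi) eta) ->
  frakP N Omega Ups <->
  bijective (fun x : H => Q x + \val (op_inv A (B (\val (op_inv A x))))).
Proof.
move=> rep qN Ups_bd HB.
have [_ [NA [NAE _ qNA]]] := represented_q_closed rep.
have [_ A_sa A_res _ HO] := rep.
have [KA AK JP J_sym _] := op_invP A_sa A_res.
have [[a1 a10 le1] c1 _ _] := qN; have [[a2 a20 le2] c2 _ _] := qNA.
have [C C0 N_le] := norm_on_equiv a10 a20 le1 le2 c1 c2.
have [C' C0' NA_le] := norm_on_equiv a20 a10 le2 le1 c2 c1.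
set G := fun x : H => _.
have GP : linear G.
  move=> a x y; rewrite /G JP !linearP JP linearP.
  by rewrite addrACA -scalerDr.
(* The key identity: [A] transports the perturbed form to the form of [G] on all of [H], since
   [A eta] runs over [H]. *)
have HG xi eta :
    Omega xi eta + Ups (\val xi) (\val eta) = ip (G (A xi)) (A eta).
  by rewrite HO HB /G AK ipDl J_sym AK.
split=> [[_ inj0 surj]|[G' GK KG]].
  have G_inj x y : G x = G y -> x = y.
    move=> Gxy; apply/subr0_eq; rewrite -[x - y]KA.
    rewrite (inj0 (op_inv A (x - y))) ?linear0// => eta.
    rewrite HG KA addrC -scaleN1r GP Gxy scaleN1r addrC subrr.
    by rewrite linear0l.
  (* Surjectivity is tested on the functionals [ip y (A eta)], which [C'] makes bounded for [N]. *)
  have G_surj y : exists x, G x = y.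
    have LamP : linear_for (conjC \; *%R) (fun eta => ip y (A eta)).
      by move=> a u v; rewrite linearP ipP_r.
    pose Lam : {antilinear D} := HB.pack (fun eta => ip y (A eta))
      (GRing.isLinear.Build R[i] D R[i] (conjC \; *%R) _ LamP).
    have [|xi Hxi] := surj Lam.
      exists (nrm ip y * C')%:C => eta; rewrite rnormE.
      apply: le_trans (_ : _ <= (nrm ip y * rnorm (A eta))%:C) _.
        by rewrite lecR -nH ipCS.
      rewrite !rmorphM -mulrA ler_wpM2l ?lecR ?nrm_ge0//.
      by have := NA_le eta; rewrite NAE rnormE.
    exists (A xi); apply: (ip_eq (ip := ip)) => z.
    by rewrite -[z]KA -HG -Hxi.
  have /choice[G' HG'] := G_surj.
  by exists G' => [x|//]; apply: G_inj; rewrite HG'.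
split=> // [xi xi0|Lam [M LamM]].
  have : G (A xi) = G 0.
    rewrite (_ : G 0 = 0); last exact: (linear0 (linear_of GP)).
    by apply: (ip_eq (ip := ip)) => z; rewrite -[z]KA -HG xi0 linear0l.
  by move=> /(can_inj GK) Axi; rewrite -[xi]AK Axi -(linear0 A) AK.
(* Pulled back along the inverse of [A], [Lam] is bounded on [H] because [C] bounds [N] by the graph
   norm; conjugation makes it linear. *)
have [||y Hy] := riesz cH (f := fun x => conjC (Lam (op_inv A x)))
    (M := `|complex.Re M| * C).
- move=> a x z; rewrite JP linearP rmorphD rmorphM; congr (_ * _ + _).
  exact: conjCK.
- move=> x; rewrite rnorm_conjC nH -mulrA.
  have NE xi : N xi = (rnorm (xi : normed_by N))%:C.
    exact: (rnormE (xi : normed_by N)).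
  have le : rnorm (Lam (op_inv A x)) <=
      complex.Re M * rnorm (op_inv A x : normed_by N).
    by rewrite -Re_mul_real -NE; exact: lec_Re (LamM _).
  apply: le_trans le _.
  apply: le_trans (_ : _ <= `|complex.Re M| * rnorm (op_inv A x : normed_by N)) _.
    by rewrite ler_wpM2r ?rnorm_ge0 ?ler_norm.
  rewrite ler_wpM2l// -lecR rmorphM -NE.
  by have := N_le (op_inv A x); rewrite NAE KA rnormE.
exists (op_inv A (G' y)) => eta.
by rewrite HG KA KG ipC -{1}[eta]AK -Hy conjCK.
Qed.

(** [Omega xi eta = <v, eta>] for all [eta] says that [(Q (A xi), v)] is in the adjoint graph of
    [A]; self-adjointness then puts [Q (A xi)] in the domain, with image [v]. *)
Lemma represented_assoc_graph Omega A (Q : {linear H -> H}) :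
  represented ip Omega A Q -> assoc_graph ip Omega = sandwich_graph A Q.
Proof.
move=> [_ A_sa _ _ HO]; apply/seteqP.
split=> [[u v] [xi /= <- xiv]|[u v] [xi [zeta [/= -> zE ->]]]].
  have : adjoint_graph ip A (Q (A xi), v).
    by move=> eta /=; rewrite ipC -HO xiv -ipC.
  by rewrite -A_sa => -[zeta _ [zE <-]]; exists xi, zeta.
exists xi => // eta; rewrite HO -zE.
have : adjoint_graph ip A (\val zeta, A zeta) by rewrite -A_sa; exists zeta.
by move=> /(_ eta) /= e; rewrite ipC e -ipC.
Qed.
End operator.

Theorem theorem3p8 (R : realType) (H : completeNormedModType R[i])
    (ip : {dot H for conjC}) (ip_norm : forall x : H, `|x| ^+ 2 = ip x x)
    (P : {pred H}) (D : subLmodType P) (denseD : dense [set x | x \in P])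
    (Omega : {sesquilinear D}) :
  let representation (A : {linear D -> H}) (Q : {linear H -> H}) :=
    [/\ positive_op ip A, self_adjoint ip A, resolvent_set A 0, bounded_map Q &
      forall xi eta : D, Omega xi eta = ip (Q (A xi)) (A eta)] in
  (q_closed_inner Omega <->
     exists (A : {linear D -> H}) (Q : {linear H -> H}), representation A Q) /\
  forall (A : {linear D -> H}) (Q : {linear H -> H}), representation A Q ->
    (forall N : norm_on D, q_closed N Omega ->
       forall (Ups : {sesquilinear H}) (B : {linear H -> H}),
         bounded_form Ups -> bounded_map B ->
         (forall xi eta : H, Ups xi eta = ip (B xi) eta) ->
         (frakP N Omega Ups <->
          bijective (fun x : H =>
            Q x + \val (op_inv A (B (\val (op_inv A x))))))) /\
    (solvable Omega -> assoc_graph ip Omega = sandwich_graph A Q).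
Proof.
split=> [|A Q rep].
  split=> [/(q_closed_inner_represented ip_norm denseD)//|[A [Q rep]]].
  have [ipA [N [_ N_ip qN]]] := represented_q_closed ip_norm rep.
  by exists ipA, N.
split=> [N qN Ups B Ups_bd _ HB|_].
  exact: (frakP_bijective ip_norm rep).
exact: (represented_assoc_graph rep).
Qed.
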